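(* For every pair of constants $p$ and $k$ (positive integers), there is a polynomial-time algorithm that, given a $K_p$-free semi-perfect graph $G$ together with a clique partition of $G$ consisting of exactly $\alpha(G)$ cliques, decides whether $\mu_\alpha(G)\le k$.
   Context: All graphs are finite, simple and undirected. $K_p$ is the complete graph on $p$ vertices; $G$ is $K_p$-free if it has no induced subgraph isomorphic to $K_p$ (i.e., no clique of size $p$). For a graph $G$, $\alpha(G)$ is the maximum size of an independent set and $i(G)$ is the minimum size of a maximal (with respect to inclusion) independent set; the independence gap is $\mu_\alpha(G)=\alpha(G)-i(G)$. $\theta(G)$ denotes the minimum number of cliques whose union is $V(G)$; $G$ is semi-perfect if $\alpha(G)=\theta(G)$. A clique partition of $G$ is a set of pairwise disjoint cliques whose union is $V(G)$. *)

(* Defs.v *)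
From mathcomp Require Import all_boot.
Set Implicit Arguments. Unset Strict Implicit. Unset Printing Implicit Defensive.

Section Graphs.
Variable n : nat.
Variable e : rel 'I_n.

Definition is_clique (S : {set 'I_n}) : bool :=
  [forall u in S, forall v in S, (u != v) ==> e u v].

Definition is_indep (S : {set 'I_n}) : bool :=
  [forall u in S, forall v in S, (u != v) ==> ~~ e u v].

Definition is_maximal_indep (S : {set 'I_n}) : bool :=
  is_indep S && [forall T : {set 'I_n}, (S \proper T) ==> ~~ is_indep T].

Definition alpha : nat := \max_(S : {set 'I_n} | is_indep S) #|S|.

Definition indep_dom : nat :=
  \big[minn/n]_(S : {set 'I_n} | is_maximal_indep S) #|S|.

Definition mu_alpha : nat := alpha - indep_dom.

Definition theta : nat :=
  \big[minn/n]_(F : {set {set 'I_n}} |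
      (cover F == [set: 'I_n]) && [forall C in F, is_clique C]) #|F|.

Definition semi_perfect : Prop := alpha = theta.

Definition Kp_free (p : nat) : Prop :=
  forall S : {set 'I_n}, is_clique S -> #|S| <> p.

Definition clique_partition (P : {set {set 'I_n}}) : Prop :=
  partition P [set: 'I_n] /\ (forall C, C \in P -> is_clique C).

Definition encode (P : {set {set 'I_n}}) : seq bool :=
  [seq e u v | u <- enum 'I_n, v <- enum 'I_n] ++
  [seq pblock P u == pblock P v | u <- enum 'I_n, v <- enum 'I_n].
End Graphs.

Inductive move := MoveL | MoveR | Stay.

Record TM := mkTM {
  tm_state : finType;
  tm_delta : tm_state -> option bool -> tm_state * option bool * move;
  tm_start : tm_state;
  tm_accept : tm_state;
  tm_reject : tm_state }.

(* configuration: state, cells to the left (nearest first), scanned cell,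
   cells to the right (nearest first); None = blank *)
Record config (M : TM) := mkConfig {
  c_state : tm_state M;
  c_left : seq (option bool);
  c_head : option bool;
  c_right : seq (option bool) }.

Definition tm_step (M : TM) (c : config M) : config M :=
  let q := c_state c in
  if (q == tm_accept M) || (q == tm_reject M) then c else
  let: (q', b, m) := tm_delta q (c_head c) in
  match m with
  | Stay => mkConfig q' (c_left c) b (c_right c)
  | MoveR => match c_right c with
             | [::] => mkConfig q' (b :: c_left c) None [::]
             | x :: r => mkConfig q' (b :: c_left c) x r
             end
  | MoveL => match c_left c with
             | [::] => mkConfig q' [::] b (c_right c)
             | x :: l => mkConfig q' l x (b :: c_right c)
             end
  end.

Definition tm_init (M : TM) (w : seq bool) : config M :=
  match w with
  | [::] => mkConfig (tm_start M) [::] None [::]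
  | b :: r => mkConfig (tm_start M) [::] (Some b) (map Some r)
  end.

Definition tm_run (M : TM) (t : nat) (w : seq bool) : config M :=
  iter t (@tm_step M) (tm_init M w).

(* Main.v *)
Require Import Defs.
From mathcomp Require Import all_boot.
From mathcomp Require Import zify.

(** If [P] consists of [alpha] cliques, every independent set meets each block at
    most once, so the gap exceeds [k] exactly when some maximal independent set
    misses [k.+1] blocks.  Blocks have fewer than [p] vertices, so this happens
    iff some [k.+1] blocks are dominated by an independent set with at most
    [k.+1 * p] vertices.  For fixed [p] and [k] that is a first-order property of
    the structure (adjacency, "same block"), and a fixed first-order property is
    decided in polynomial time by nested loops over the vertices. *)

Set Implicit Arguments. Unset Strict Implicit. Unset Printing Implicit Defensive.

(** * Structured tape programs *)

(** The claim is about machines of type [TM]: a single tape, infinite to the right only, over [bool]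
    and a blank, whose state is inspected at one prescribed time. The loops have to be carried out
    there, and two facts keep this manageable. Every number that occurs while a formula is evaluated
    (a vertex, an address in the word, the order [n]) is at most the input length
    [N = n * n + n * n], so a register can be kept in unary, as one mark in a row of [N + 1] blocks.
    The number of registers depends on the formula alone, so the block width is a constant built
    into the program. Storing one input bit in each block then makes the look-up of a bit and the
    comparison of two registers the same operation: find the block marked by a register and read
    another of its cells. Correctness and running time are proved together, and only polynomiality
    matters, so the time bounds are coarse. *)

Notation symbol := (option bool) (only parsing).
Definition tape : Type := ((nat -> symbol) * nat)%type.
Definition scanned (c : tape) : symbol := c.1 c.2.

Definition upd T (f : nat -> T) (i : nat) (b : T) : nat -> T :=
  fun j => if j == i then b else f j.

Lemma upd_same T (f : nat -> T) i b : upd f i b i = b.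
Proof. by rewrite /upd eqxx. Qed.

Lemma upd_other T (f : nat -> T) i b j : j != i -> upd f i b j = f j.
Proof. by rewrite /upd => /negbTE ->. Qed.

Definition shift (m : move) (i : nat) : nat :=
  match m with MoveL => i.-1 | MoveR => i.+1 | Stay => i end.

(** As a write instruction, [None] leaves the scanned symbol in place, whereas [Some None] erases
    it. The predecessor in [shift] fixes position 0, just as a left move at the edge does in
    [tm_step]. *)
Definition act (o : option symbol) (m : move) (c : tape) : tape :=
  (if o is Some b then upd c.1 c.2 b else c.1, shift m c.2).

Inductive prog :=
  | Act of option symbol & move
  | Seq of prog & prog
  | If of (symbol -> bool) & prog & prog
  | While of (symbol -> bool) & prog.

Fixpoint pstate (p : prog) : finType :=
  match p with
  | Act _ _ => unit
  | Seq p q => (pstate p + pstate q)%type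
  | If _ p q => option (pstate p + pstate q)%type
  | While _ p => option (pstate p)
  end.

Fixpoint pstart (p : prog) : pstate p :=
  match p with
  | Act _ _ => tt
  | Seq p _ => inl (pstart p)
  | If _ _ _ => None
  | While _ _ => None
  end.

(* A missing next state means that the program has terminated. *)
Fixpoint pdelta (p : prog) :
    pstate p -> symbol -> option (pstate p) * option symbol * move :=
  match p return pstate p -> symbol ->
                 option (pstate p) * option symbol * move with
  | Act o m => fun _ _ => (None, o, m)
  | Seq p q => fun s a =>
      match s with
      | inl s => let: (s', o, m) := pdelta s a in
                 (Some (if s' is Some s'' then inl s'' else inr (pstart q)), o, m)
      | inr s => let: (s', o, m) := pdelta s a in (omap inr s', o, m)
      end
  | If t p q => fun s a =>
      match s with
      | None =>
          (Some (Some (if t a then inl (pstart p) else inr (pstart q))), None, Stay)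
      | Some (inl s) => let: (s', o, m) := pdelta s a in
                        (omap (fun x => Some (inl x)) s', o, m)
      | Some (inr s) => let: (s', o, m) := pdelta s a in
                        (omap (fun x => Some (inr x)) s', o, m)
      end
  | While t p => fun s a =>
      match s with
      | None => (if t a then Some (Some (pstart p)) else None, None, Stay)
      | Some s => let: (s', o, m) := pdelta s a in (Some s', o, m)
      end
  end.

Inductive runs (p : prog) : pstate p -> tape -> tape -> nat -> Prop :=
  | RunsEnd s c o m : pdelta s (scanned c) = (None, o, m) ->
      runs s c (act o m c) 1
  | RunsStep s c o m s' c' t : pdelta s (scanned c) = (Some s', o, m) ->
      runs s' (act o m c) c' t -> runs s c c' t.+1.

Lemma act_stay c : act None Stay c = c.
Proof. by case: c. Qed.

Lemma runs_Act o m c : runs (pstart (Act o m)) c (act o m c) 1.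
Proof. exact: RunsEnd. Qed.

Lemma runs_Seqr p q s c c' t :
  runs s c c' t -> @runs (Seq p q) (inr s) c c' t.
Proof.
move=> H; elim: H => {s c c' t} [s c o m E|s c o m s' c' t E _].
  by apply: RunsEnd; rewrite /= E.
by apply: RunsStep; rewrite /= E.
Qed.

Lemma runs_Seq p q s c c' c'' t t' :
  runs s c c' t -> runs (pstart q) c' c'' t' ->
  @runs (Seq p q) (inl s) c c'' (t + t').
Proof.
move=> H /(@runs_Seqr p) H'.
elim: H H' => {s c c' t} [s c o m E|s c o m s' c' t E _ IH] H'.
  by apply: RunsStep H'; rewrite /= E.
by rewrite addSn; apply: RunsStep (IH H'); rewrite /= E.
Qed.

Lemma runs_Ifl f p q s c c' t :
  runs s c c' t -> @runs (If f p q) (Some (inl s)) c c' t.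
Proof.
move=> H; elim: H => {s c c' t} [s c o m E|s c o m s' c' t E _].
  by apply: RunsEnd; rewrite /= E.
by apply: RunsStep; rewrite /= E.
Qed.

Lemma runs_Ifr f p q s c c' t :
  runs s c c' t -> @runs (If f p q) (Some (inr s)) c c' t.
Proof.
move=> H; elim: H => {s c c' t} [s c o m E|s c o m s' c' t E _].
  by apply: RunsEnd; rewrite /= E.
by apply: RunsStep; rewrite /= E.
Qed.

Lemma runs_If f p q c c' t :
  (if f (scanned c) then runs (pstart p) c c' t else runs (pstart q) c c' t) ->
  runs (pstart (If f p q)) c c' t.+1.
Proof.
case E: (f _) => H; apply: (@RunsStep _ _ _ None Stay); rewrite /= ?E //.
  by rewrite act_stay; apply: runs_Ifl.
by rewrite act_stay; apply: runs_Ifr.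
Qed.

Lemma runs_While_end f p c :
  ~~ f (scanned c) -> runs (pstart (While f p)) c c 1.
Proof.
move=> /negbTE E; rewrite -[X in runs _ _ X _]act_stay.
by apply: RunsEnd; rewrite /= E.
Qed.

Lemma runs_While_body f p s c c' c'' t t' :
  runs s c c' t -> runs (pstart (While f p)) c' c'' t' ->
  @runs (While f p) (Some s) c c'' (t + t').
Proof.
move=> H H'; elim: H H' => {s c c' t} [s c o m E|s c o m s' c' t E _ IH] H'.
  by apply: RunsStep H'; rewrite /= E.
by rewrite addSn; apply: RunsStep (IH H'); rewrite /= E.
Qed.

Lemma runs_While_step (f : symbol -> bool) p c c' c'' t t' : f (scanned c) ->
  runs (pstart p) c c' t -> runs (pstart (While f p)) c' c'' t' ->
  runs (pstart (While f p)) c c'' (t + t').+1.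
Proof.
move=> E H H'; apply: (@RunsStep _ _ _ None Stay); first by rewrite /= E.
by rewrite act_stay; apply: runs_While_body H H'.
Qed.

(** * Simulation of structured programs by Turing machines *)

Section Compile.
Variable p : prog.

(* After the program has terminated, the state [inr None] reads the verdict
   off the scanned cell. *)
Definition tm_of : TM :=
  @mkTM (pstate p + option bool)%type
    (fun s a => match s with
     | inl s => let: (s', o, m) := pdelta s a in
         (if s' is Some s'' then inl s'' else inr None, odflt a o, m)
     | inr _ => (inr (Some (a == Some true)), a, Stay)
     end)
    (inl (pstart p)) (inr (Some true)) (inr (Some false)).

(** The left list has exactly [c.2] entries, so the edge of the machine tape is position 0. The
    right list may stop early: beyond its end [nth None] reads the blanks that [tm_step] creates on
    demand. *)
Definition represents (k : config tm_of) (c : tape) : Prop :=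
  [/\ size (c_left k) = c.2,
      forall i, i < c.2 -> nth None (c_left k) i = c.1 (c.2 - i.+1),
      c_head k = scanned c &
      forall i, nth None (c_right k) i = c.1 (c.2 + i.+1)].

Definition live (q : tm_state tm_of) : bool :=
  (q != tm_accept tm_of) && (q != tm_reject tm_of).

Lemma represents_step (k : config tm_of) c q o m :
  live (c_state k) -> represents k c ->
  tm_delta (c_state k) (scanned c) = (q, odflt (scanned c) o, m) ->
  c_state (tm_step k) = q /\ represents (tm_step k) (act o m c).
Proof.
case: k => st l h r; case: c => f pos; rewrite /represents /scanned /=.
move=> /andP[/negbTE h1 /negbTE h2] [sl nl -> nr] E.
rewrite /tm_step /= h1 h2 /= E.
set f' := if o is Some b then upd f pos b else f.
have fp : odflt (f pos) o = f' pos by rewrite /f'; case: (o) => //= b; rewrite upd_same.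
have fo j : j != pos -> f' j = f j.
  by rewrite /f'; case: (o) => //= b ?; rewrite upd_other.
case: m {E} => /=.
- case: l sl nl => [|x l] /= sl nl.
    subst pos; split=> //; split=> //= i.
    by rewrite nr fo //; lia.
  subst pos; split=> //=; split=> //=.
  + move=> i lti; have := nl i.+1; rewrite /= => ->; last lia.
    by rewrite fo; [congr f; lia|lia].
  + have := nl 0; rewrite /= => ->; last lia.
    by rewrite fo; [congr f; lia|lia].
  + case=> [|i] /=; first by rewrite fp; congr f'; lia.
    by rewrite nr fo; [congr f; lia|lia].
- case: r nr => [|x r] /= nr; split=> //; split=> /=; rewrite ?sl //.
  + case=> [|i] lti /=; first by rewrite fp; congr f'; lia.
    by rewrite nl; [rewrite fo; [congr f; lia|lia]|lia].
  + by have := nr 0; rewrite /= fo; [rewrite addn1|lia].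
  + by move=> i; have := nr i.+1; rewrite !nth_nil fo; [move=> ->; congr f; lia|lia].
  + case=> [|i] lti /=; first by rewrite fp; congr f'; lia.
    by rewrite nl; [rewrite fo; [congr f; lia|lia]|lia].
  + by have := nr 0; rewrite /= fo; [rewrite addn1|lia].
  + by move=> i; have := nr i.+1; rewrite /= fo; [move=> ->; congr f; lia|lia].
- split=> //; split=> //=.
  + by move=> i lti; rewrite nl // fo //; lia.
  + by move=> i; rewrite nr // fo //; lia.
Qed.

Lemma represents_runs s c c' t (k : config tm_of) :
  runs s c c' t -> c_state k = inl s -> represents k c ->
  c_state (iter t (@tm_step tm_of) k) = inr None /\
  represents (iter t (@tm_step tm_of) k) c'.
Proof.
move=> R; elim: R k => {s c c' t} [s c o m E|s c o m s' c' t E].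
  move=> k ks rk; apply: represents_step rk _; first by rewrite ks.
  by rewrite ks /= E.
move=> _ IH k ks rk; rewrite iterSr.
have [||st' rep'] := @represents_step k c (inl s') o m _ rk; rewrite ?ks //=.
  by rewrite E.
exact: IH.
Qed.

(** The strict inequality [t < t'] pays for the extra step that reads the verdict. From then on the
    state is constant, because [tm_step] fixes halting configurations; this allows a single
    inspection at any sufficiently late time. *)
Lemma tm_of_correct w c' t t' (b : bool) :
  runs (pstart p) (nth None (map Some w), 0) c' t -> scanned c' = Some b -> t < t' ->
  c_state (tm_run tm_of t' w) = if b then tm_accept tm_of else tm_reject tm_of.
Proof.
move=> R sb ltt.
have [||st rep] := @represents_runs _ _ _ _ (tm_init tm_of w) R.
- by case: w {R}.
- by case: w {R} => [|a w]; split=> //= i; rewrite ?nth_nil.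
have [||st' _] := @represents_step _ c' (inr (Some b)) None Stay _ rep; rewrite ?st //=.
  by rewrite sb; case: (b).
rewrite /tm_run -(subnK ltt) iterD /=.
elim: (t' - t.+1) => [|j IH] /=; first by rewrite st'; case: (b).
by rewrite /tm_step IH; case: (b) IH => IH; rewrite eqxx ?orbT IH.
Qed.
End Compile.

(** * Weakest preconditions with time bounds *)

Definition wp (p : prog) (t : nat) (Q : tape -> Prop) (c : tape) : Prop :=
  exists c' t', [/\ t' <= t, runs (pstart p) c c' t' & Q c'].

Lemma wp_mono p t t' (Q Q' : tape -> Prop) c :
  t <= t' -> (forall c', Q c' -> Q' c') -> wp p t Q c -> wp p t' Q' c.
Proof.
by move=> le_t QQ' [c' [u [le_u r q]]]; exists c', u; split; [lia| |exact: QQ'].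
Qed.

Lemma wp_time t p t' (Q : tape -> Prop) c : wp p t Q c -> t <= t' -> wp p t' Q c.
Proof. by move=> h le_t; apply: wp_mono h. Qed.

Lemma wp_Act o m (Q : tape -> Prop) c : Q (act o m c) -> wp (Act o m) 1 Q c.
Proof. by exists (act o m c), 1; split=> //; apply: runs_Act. Qed.

Lemma wp_Seq p q t t' (Q : tape -> Prop) c :
  wp p t (wp q t' Q) c -> wp (Seq p q) (t + t') Q c.
Proof.
case=> c' [u [le_u r [c'' [v [le_v r' qc]]]]].
by exists c'', (u + v); split=> //; [lia|apply: runs_Seq r r'].
Qed.

Lemma wp_If f p q t (Q : tape -> Prop) c :
  wp (if f (scanned c) then p else q) t Q c -> wp (If f p q) t.+1 Q c.
Proof.
case=> c' [u [le_u r qc]]; exists c', u.+1; split=> //.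
by apply: runs_If; case: (f _) r.
Qed.

(** The index of [I] counts the iterations still to come. It decides the test and is both the
    termination measure and the factor in the time bound; every evaluation of the test costs one
    step, including the last one, which fails. *)
Lemma wp_While (I : nat -> tape -> Prop) (f : symbol -> bool) p t (Q : tape -> Prop) k c :
  (forall i c, I i.+1 c -> f (scanned c) /\ wp p t (I i) c) ->
  (forall c, I 0 c -> ~~ f (scanned c) /\ Q c) ->
  I k c -> wp (While f p) (k * t.+1).+1 Q c.
Proof.
move=> step base; elim: k c => [|k IH] c Ic.
  by case: (base _ Ic) => fc qc; exists c, 1; split=> //; apply: runs_While_end.
have [fc [c1 [u [le_u r I1]]]] := step _ _ Ic.
have [c' [v [le_v r' qc]]] := IH _ I1.
exists c', (u + v).+1; split=> //; first by rewrite mulSn; lia.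
exact: runs_While_step r r'.
Qed.

Definition skip := Act None Stay.
Definition go_right := Act None MoveR.
Definition go_left := Act None MoveL.
Definition put b m := Act (Some (Some b)) m.
Definition nonblank (a : symbol) := a != None.
Definition marked (a : symbol) := a == Some true.
Definition unmarked (a : symbol) := a != Some true.

Fixpoint times k p := if k is k'.+1 then Seq p (times k' p) else skip.

Lemma wp_skip (Q : tape -> Prop) c : Q c -> wp skip 1 Q c.
Proof. by move=> q; apply: wp_Act; rewrite act_stay. Qed.

Lemma wp_rights k (Q : tape -> Prop) f i :
  Q (f, i + k) -> wp (times k go_right) k.+1 Q (f, i).
Proof.
elim: k i => [|k IH] i q /=; first by apply: wp_skip; rewrite addn0 in q.
by apply: (@wp_Seq _ _ 1); apply: wp_Act; apply: IH; rewrite addSnnS.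
Qed.

Lemma wp_lefts k (Q : tape -> Prop) f i :
  Q (f, i - k) -> wp (times k go_left) k.+1 Q (f, i).
Proof.
elim: k i => [|k IH] i q /=; first by apply: wp_skip; rewrite subn0 in q.
by apply: (@wp_Seq _ _ 1); apply: wp_Act; apply: IH; have <- : i - k.+1 = i.-1 - k by lia.
Qed.

Lemma wp_puts k b (Q : tape -> Prop) f i :
  (forall f', (forall j, f' j = if i <= j < i + k then Some b else f j) ->
              Q (f', i + k)) ->
  wp (times k (put b MoveR)) k.+1 Q (f, i).
Proof.
elim: k f i => [|k IH] f i q /=.
  by apply: wp_skip; have := q f; rewrite addn0; apply=> j; case: ifP => //; lia.
apply: (@wp_Seq _ _ 1); apply: wp_Act; apply: IH => f' f'E.
rewrite [_ + k]addSnnS; apply: q => j; rewrite f'E /upd /=.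
by repeat case: ifP => ?; move=> //; lia.
Qed.

Definition scan_right := While nonblank go_right.
Definition scan_left := While nonblank go_left.

Lemma wp_scan_right f i q (Q : tape -> Prop) : i <= q -> f q = None ->
  (forall j, i <= j < q -> f j != None) ->
  Q (f, q) -> wp scan_right ((q - i) * 2).+1 Q (f, i).
Proof.
move=> le_iq fq fN Qq.
apply: (@wp_While (fun k c => c = (f, q - k) /\ k <= q - i)).
- move=> k c [-> le_k]; split; first by apply: fN => /=; lia.
  by apply: wp_Act; split; [congr (_, _) => /=; lia|lia].
- by move=> c [-> _]; rewrite subn0 /scanned /nonblank /= fq.
- by split=> //; congr (_, _); lia.
Qed.

Lemma wp_scan_left f i q (Q : tape -> Prop) : q <= i -> f q = None ->
  (forall j, q < j <= i -> f j != None) ->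
  Q (f, q) -> wp scan_left ((i - q) * 2).+1 Q (f, i).
Proof.
move=> le_iq fq fN Qq.
apply: (@wp_While (fun k c => c = (f, q + k) /\ k <= i - q)).
- move=> k c [-> le_k]; split; first by apply: fN => /=; lia.
  by apply: wp_Act; split; [congr (_, _) => /=; lia|lia].
- by move=> c [-> _]; rewrite addn0 /scanned /nonblank /= fq.
- by split=> //; congr (_, _); lia.
Qed.

(** * Unary registers on the tape *)

Section Layout.
Variables (w : seq bool) (R : nat).
Local Notation N := (size w).

(* After preprocessing the input is erased and replaced by [N.+1] blocks of [R.+1]
   cells, to the right of a blank cell at position [N].  Cell 0 of block [i] holds
   input bit [i]; cell [x] of block [i] is set iff register [x] has value [i]. *)
Definition cell (i x : nat) : nat := N.+1 + (i * R.+1 + x).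

Lemma cell_inj i x i' x' : x <= R -> x' <= R ->
  (cell i x == cell i' x') = (i == i') && (x == x').
Proof.
move=> hx hx'; rewrite /cell eqn_add2l; apply/eqP/andP => [E|[/eqP-> /eqP->]] //.
have Ei : i = i'.
  by have := congr1 (divn^~ R.+1) E; rewrite /= !divnMDl // !divn_small ?addn0.
by split; apply/eqP; [|apply: (@addnI (i * R.+1)); rewrite E Ei].
Qed.

Lemma cellP m j : N < j < cell m 0 ->
  exists i x, [/\ i < m, x <= R & j = cell i x].
Proof.
rewrite /cell => hj; exists ((j - N.+1) %/ R.+1), ((j - N.+1) %% R.+1).
split; [|by rewrite -ltnS ltn_pmod|].
  by rewrite ltn_divLR //; lia.
by rewrite -divn_eq; lia.
Qed.

Lemma cellD i x : cell i x = cell i 0 + x.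
Proof. by rewrite /cell addn0 addnA. Qed.

Lemma cellS i : cell i.+1 0 = cell i 0 + R.+1.
Proof. by rewrite /cell mulSn; lia. Qed.

Lemma ltn_cell i x i' : i < i' -> x <= R -> cell i x < cell i' 0.
Proof.
by move=> hi hx; have := leq_mul2r R.+1 i.+1 i'; rewrite hi orbT mulSn /cell; lia.
Qed.

Lemma cell_bound i x : i <= N -> x <= R -> cell i x < N.+1 + N.+1 * R.+1.
Proof.
move=> hi hx; rewrite /cell ltn_add2l mulSn.
have := leq_mul2r R.+1 i N; rewrite hi orbT; lia.
Qed.

(** The blank at [N] is the only landmark: all cells of the blocks are nonblank, so a leftward scan
    from anywhere among them stops exactly there. *)
Definition grid (g : nat -> nat -> bool) (i x : nat) (c : tape) : Prop :=
  [/\ c.2 = cell i x, c.1 N = None &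
      forall i' x', i' <= N -> x' <= R -> c.1 (cell i' x') = Some (g i' x')].

Lemma grid_scanned g i x c : i <= N -> x <= R -> grid g i x c ->
  scanned c = Some (g i x).
Proof. by move=> hi hx [E _ h]; rewrite /scanned E h. Qed.

Lemma grid_ext g g' i x c :
  (forall i x, i <= N -> x <= R -> g i x = g' i x) -> grid g i x c -> grid g' i x c.
Proof. by move=> E [h1 h2 h3]; split=> // i' x' hi hx; rewrite h3 // E. Qed.

Lemma wp_put g b i x c (Q : tape -> Prop) : i <= N -> x <= R -> grid g i x c ->
  (forall c', grid (fun i' x' => if (i' == i) && (x' == x) then b else g i' x') i x c' ->
     Q c') ->
  wp (put b Stay) 1 Q c.
Proof.
case: c => f pos hi hx [/= -> h2 h3] H; apply: wp_Act; apply: H; split=> //=.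
  by rewrite upd_other // /cell; lia.
by move=> i' x' hi' hx'; rewrite /upd cell_inj //; case: ifP => // _; rewrite h3.
Qed.

Definition home := Seq scan_left go_right.
Definition sweep := (N.+1 * R.+1) * 2 + 2.

Lemma wp_home g i x c (Q : tape -> Prop) : i <= N -> x <= R -> grid g i x c ->
  (forall c', grid g 0 0 c' -> Q c') -> wp home sweep Q c.
Proof.
case: c => f pos hi hx [/= -> h2 h3] H.
have hc := cell_bound hi hx; have cN : N < cell i x by rewrite /cell; lia.
apply: (@wp_time (((cell i x - N) * 2).+1 + 1)); last by rewrite /sweep; lia.
apply: wp_Seq; apply: wp_scan_left => //; first exact: ltnW.
  move=> j hj; have [|i' [x' [hi' hx' ->]]] := @cellP N.+1 j.
    by move: hj hc; rewrite /cell; lia.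
  by rewrite h3.
by apply: wp_Act; apply: H; split=> //=; rewrite /cell; lia.
Qed.

Definition bits (s : nat -> nat) (i x : nat) : bool :=
  if x == 0 then nth false w i else s x == i.

Definition layout (s : nat -> nat) (i x : nat) (c : tape) : Prop :=
  grid (bits s) i x c /\ forall y, s y <= N.

Definition registers s := layout s 0 0.

(** From the first cell of block 0, the head enters column [x] and jumps by whole blocks until it
    meets the mark, so the number of jumps is the value of the register. This needs [x] positive,
    since column 0 holds the input. *)
Definition goto x := Seq (times x go_right) (While unmarked (times R.+1 go_right)).

Definition slide x j := if x <= j then times (j - x) go_right else times (x - j) go_left.

(** For [j = 0] this reads the input bit whose index is the value of register [x]. For a register
    [j] it tests equality of the two registers, since their marks lie in the same block exactly when
    the values agree. *)
Definition look x j := Seq (goto x) (slide x j).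

Lemma wp_goto s x c (Q : tape -> Prop) : 0 < x <= R -> registers s c ->
  (forall c', layout s (s x) x c' -> Q c') ->
  wp (goto x) (x.+1 + (N * R.+3).+1) Q c.
Proof.
case: c => f pos hx [[/= E h2 h3] hs] H; apply: wp_Seq; apply: wp_rights.
rewrite E; apply: (@wp_time (s x * R.+3).+1); last first.
  by rewrite ltnS leq_mul2r hs orbT.
apply: (@wp_While (fun k c => layout s (s x - k) x c /\ k <= s x)).
- move=> k {f pos E h2 h3} [f pos] [[g _] hk]; split.
    rewrite (grid_scanned _ _ g); [|have := hs x; lia|lia].
    by rewrite /bits /unmarked; case: (x =P 0) => ?; [lia|case: (s x =P _) => // ?; lia].
  apply: wp_rights; split; last lia.
  split=> //; case: g => /= -> h2 h3; split=> //=; rewrite /cell.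
  by have -> : s x - k = (s x - k.+1).+1; [lia|rewrite mulSn; lia].
- move=> c [lay _]; rewrite subn0 in lay; split; last exact: H.
  case: lay => g _; rewrite (grid_scanned _ _ g) //; last lia.
  by rewrite /bits /unmarked; case: (x =P 0) => ?; [lia|rewrite eqxx].
- rewrite subnn; split=> //; split=> //; split=> //=.
  by rewrite /cell; lia.
Qed.

Lemma wp_look s x j c (Q : tape -> Prop) : 0 < x <= R -> j <= R -> registers s c ->
  (forall c', layout s (s x) j c' -> scanned c' = Some (bits s (s x) j) -> Q c') ->
  wp (look x j) (x.+1 + (N * R.+3).+1 + R.+1) Q c.
Proof.
move=> hx hj hs H; apply: wp_Seq; apply: (wp_goto _ hs) => // -[f pos] [[/= -> h2 h3] hs'].
have K : Q (f, cell (s x) j) by apply: H => //; rewrite /scanned /= h3.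
rewrite /slide; case: leqP => hxj.
  apply: wp_time; first by apply: (@wp_rights (j - x)); rewrite /cell -!addnA subnKC.
  lia.
apply: wp_time; first (apply: (@wp_lefts (x - j))); last lia.
by rewrite /cell addnA -addnBA ?leq_subr // subKn -?addnA // ltnW.
Qed.

Definition zero x :=
  Seq (goto x) (Seq (put false Stay) (Seq home (Seq (times x go_right) (Seq (put true Stay) home)))).

Definition inc x :=
  Seq (goto x) (Seq (put false Stay) (Seq (times R.+1 go_right) (Seq (put true Stay) home))).

Definition branch x j p q := Seq (look x j) (If marked (Seq home p) (Seq home q)).

Definition until x j p :=
  Seq (look x j) (Seq (While unmarked (Seq home (Seq p (look x j)))) home).

(** A common bound for every primitive, and for the overhead of [branch] and of each round of
    [until], proportional to the number of cells. The factor 20 is generous slack. *)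
Definition prim := 20 * (R.+1 * N.+2).

Lemma wp_zero s x c (Q : tape -> Prop) : 0 < x <= R -> registers s c ->
  (forall c', registers (upd s x 0) c' -> Q c') -> wp (zero x) prim Q c.
Proof.
move=> hx hs H.
apply: (@wp_time ((x.+1 + (N * R.+3).+1) + (1 + (sweep + (x.+1 + (1 + sweep)))))); last first.
  by rewrite /prim /sweep; lia.
apply: wp_Seq; apply: (wp_goto _ hs) => // {hs} c1 [g1 hs].
apply: wp_Seq; apply: (wp_put _ _ g1) => //; first lia.
move=> c2 g2; apply: wp_Seq; apply: (wp_home _ _ g2) => //; first lia.
move=> [f pos] g3; apply: wp_Seq; apply: wp_rights.
have {}g3 : grid (fun i' x' : nat => if (i' == s x) && (x' == x) then false else bits s i' x')
   0 x (f, pos + x).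
  by case: g3 => /= -> h2 h3; split=> //=; rewrite /cell; lia.
apply: wp_Seq; apply: (wp_put _ _ g3) => //; first lia.
move=> c4 g4; apply: (wp_home _ _ g4) => //; first lia.
move=> c5 g5; apply: H; split; last by move=> y; rewrite /upd; case: ifP.
apply: grid_ext g5 => i y hi hy; rewrite /bits /upd; case: (y =P 0) => [->|ny].
  have -> : (0 == x) = false by lia.
  by rewrite !andbF.
by case: (y =P x) => [->|ne]; rewrite ?andbT ?andbF // [0 == i]eq_sym;
  case: (i =P 0) => //; rewrite [s x == i]eq_sym; case: ifP.
Qed.

Lemma wp_inc s x c (Q : tape -> Prop) : 0 < x <= R -> s x < N -> registers s c ->
  (forall c', registers (upd s x (s x).+1) c' -> Q c') -> wp (inc x) prim Q c.
Proof.
move=> hx sx hs H.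
apply: (@wp_time ((x.+1 + (N * R.+3).+1) + (1 + (R.+2 + (1 + sweep))))); last first.
  by rewrite /prim /sweep; lia.
apply: wp_Seq; apply: (wp_goto _ hs) => // {hs} c1 [g1 hs].
apply: wp_Seq; apply: (wp_put _ _ g1) => //; first lia.
move=> [f pos] g3; apply: wp_Seq; apply: wp_rights.
have {}g3 : grid (fun i' x' : nat => if (i' == s x) && (x' == x) then false else bits s i' x')
   (s x).+1 x (f, pos + R.+1).
  by case: g3 => /= -> h2 h3; split=> //=; rewrite /cell; lia.
apply: wp_Seq; apply: (wp_put _ _ g3) => //; first lia.
move=> c4 g4; apply: (wp_home _ _ g4) => //; first lia.
move=> c5 g5; apply: H; split; last by move=> y; rewrite /upd; case: ifP.
apply: grid_ext g5 => i y hi hy; rewrite /bits /upd; case: (y =P 0) => [->|ny].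
  have -> : (0 == x) = false by lia.
  by rewrite !andbF.
case: (y =P x) => [->|ne]; rewrite ?andbT ?andbF // [_.+1 == i]eq_sym.
by case: (i =P _) => //; rewrite [s x == i]eq_sym; case: ifP.
Qed.

Lemma wp_branch s x j p q t c (Q : tape -> Prop) : 0 < x <= R -> j <= R ->
  registers s c ->
  (forall c', registers s c' -> wp (if bits s (s x) j then p else q) t Q c') ->
  wp (branch x j p q) (prim + t) Q c.
Proof.
move=> hx hj hs H.
apply: (@wp_time ((x.+1 + (N * R.+3).+1 + R.+1) + (sweep + t).+1)); last first.
  by rewrite /prim /sweep; lia.
apply: wp_Seq; apply: (wp_look _ _ hs) => // c1 [g1 hs1] E.
apply: wp_If; rewrite E /marked.
have L r : (forall c', registers s c' -> wp r t Q c') -> wp (Seq home r) (sweep + t) Q c1.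
  move=> Hr; apply: wp_Seq; apply: (wp_home _ _ g1) => //.
  by move=> c2 g2; apply: Hr.
by case: (bits _ _ _) H => H; apply: L.
Qed.

Lemma wp_until (I : nat -> (nat -> nat) -> Prop) x j p t k s c (Q : tape -> Prop) :
  0 < x <= R -> j <= R -> registers s c -> I k s ->
  (forall i s, I i.+1 s -> bits s (s x) j = false) ->
  (forall s, I 0 s -> bits s (s x) j) ->
  (forall i s c, registers s c -> I i.+1 s ->
     wp p t (fun c' => exists2 s', registers s' c' & I i s') c) ->
  (forall s c, registers s c -> I 0 s -> Q c) ->
  wp (until x j p) (prim + k * (prim + t)) Q c.
Proof.
move=> hx hj hs Iks bit1 bit0 step base.
pose lk := x.+1 + (N * R.+3).+1 + R.+1.
apply: (@wp_time (lk + ((k * (sweep + (t + lk)).+1).+1 + sweep))); last first.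
  have h1 : lk + 1 + sweep <= prim by rewrite /prim /sweep /lk; lia.
  have : k * (sweep + (t + lk)).+1 <= k * (prim + t) by rewrite leq_mul2l; lia.
  by lia.
apply: wp_Seq; apply: (wp_look _ _ hs) => // c1 g1 E1.
apply: wp_Seq.
apply: (@wp_While (fun k c => exists2 s, I k s &
   layout s (s x) j c /\ scanned c = Some (bits s (s x) j))); last by exists s.
  move=> i {Iks hs g1 E1}c [{}s Is [[g hs] E]].
  rewrite E (bit1 _ _ Is); split=> //.
  apply: wp_Seq; apply: (wp_home _ _ g) => // c2 g2.
  apply: wp_Seq; apply: wp_mono (step i s c2 _ Is) => // c3 [s' hs' Is'].
  by apply: (wp_look _ _ hs') => // c4 g4 E4; exists s'.
move=> {Iks hs g1 E1}c [{}s Is [[g hs] E]].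
rewrite E bit0 //; split=> //.
by apply: (wp_home _ _ g) => // c2 g2; apply: (base s).
Qed.

(* Erases the leftmost remaining input bit [b] and appends its block. *)
Definition transfer b :=
  Seq (Act (Some None) MoveR) (Seq scan_right (Seq go_right (Seq scan_right
  (Seq (put b MoveR) (Seq (times R (put false MoveR))
  (Seq go_left (Seq scan_left (Seq go_left (Seq scan_left go_right))))))))).

(** The block appended last has no input bit. Setting all its register cells gives every register
    the value [N], so a register that is never written afterwards holds the input length without any
    counting. *)
Definition prepare :=
  Seq (While nonblank (If marked (transfer true) (transfer false)))
  (Seq go_right (Seq scan_right (Seq (put false MoveR)
  (Seq (times R (put true MoveR)) (Seq go_left home))))).

(** The blank at [N] separates the unread word from the blocks and ends the loop when the head
    reaches it. The last clause also provides the blank at [cell i 0], where the search for the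
    place of the next block stops. *)
Definition transferred (i : nat) (c : tape) : Prop :=
  [/\ c.2 = i, i <= N,
      forall j, i <= j < N -> c.1 j = Some (nth false w j),
      forall i' x, i' < i -> x <= R ->
        c.1 (cell i' x) = Some ((x == 0) && nth false w i') &
      forall j, (j == N) || (cell i 0 <= j) -> c.1 j = None].

Lemma transferred0 : transferred 0 (nth None (map Some w), 0).
Proof.
split=> //= [j hj|j hj]; first by rewrite (nth_map false).
by rewrite nth_default // size_map; move: hj; rewrite /cell; lia.
Qed.

Lemma wp_transfer i c : i < N -> transferred i c ->
  wp (transfer (nth false w i)) prim (transferred i.+1) c.
Proof.
case: c => f pos hi [/= -> _ hw hc hN].
have cgt i' x : N < cell i' x by rewrite /cell; lia.
have cN := cgt i 0.
have hcell j : N < j < cell i 0 -> f j != None.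
  by move=> /cellP[i' [x' [hi' hx' ->]]]; rewrite hc.
have hword j : i <= j < N -> f j != None by move=> /hw ->.
have fN : f N = None by rewrite hN ?eqxx.
have Ec : cell i 0 = N.+1 + i * R.+1 by rewrite /cell addn0.
have lim : cell i 0 + R <= N.+1 + N * R.+1.
  rewrite Ec -addnA leq_add2l.
  by have := leq_mul2r R.+1 i.+1 N; rewrite hi orbT mulSn; lia.
apply: (@wp_time (1 + (((N - i.+1) * 2).+1 + (1 + (((cell i 0 - N.+1) * 2).+1 +
  (1 + (R.+1 + (1 + (((cell i 0 + R - N) * 2).+1 + (1 +
  (((N.-1 - i) * 2).+1 + 1))))))))))); last by rewrite /prim; lia.
apply: wp_Seq; apply: wp_Act; rewrite /act /=.
apply: wp_Seq; apply: wp_scan_right => //; first by rewrite upd_other //; lia.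
  by move=> j hj; rewrite upd_other; [apply: hword|]; lia.
apply: wp_Seq; apply: wp_Act; rewrite /act /=.
apply: wp_Seq; apply: wp_scan_right => //.
- by rewrite upd_other; [apply: hN; rewrite leqnn orbT|]; lia.
- by move=> j hj; rewrite upd_other; [apply: hcell|]; lia.
apply: wp_Seq; apply: wp_Act; rewrite /act /=.
apply: wp_Seq; apply: wp_puts => f' f'E.
have {}f'E j : f' j = if j == i then None else
    if cell i 0 <= j <= cell i 0 + R then Some ((j == cell i 0) && nth false w i) else f j.
  by rewrite f'E /upd; repeat case: eqP => ?; repeat case: ifP => ? //; lia.
apply: wp_Seq; apply: wp_Act; rewrite /act /=.
apply: wp_Seq; apply: wp_scan_left; first by lia.
- by rewrite f'E; case: ifP => // _; case: ifP => //; lia.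
- move=> j hj; rewrite f'E; case: ifP => ?; first by lia.
  by case: ifP => // ?; apply: hcell; lia.
apply: wp_Seq; apply: wp_Act; rewrite /act /=.
(* This second leftward scan is stopped by cell [i], which was blanked at the start of the
   transfer. *)
apply: wp_Seq; apply: wp_scan_left; first by lia.
- by rewrite f'E eqxx.
- move=> j hj; rewrite f'E; case: ifP => ?; first by lia.
  by case: ifP => // ?; apply: hword; lia.
apply: wp_Act; split=> //=.
- by move=> j hj; rewrite f'E; do 2?[case: ifP => ?; first by lia]; apply: hw; lia.
- move=> i' x hi' hx; rewrite f'E; case: ifP => ?; first by have := cgt i' x; lia.
  case: (ltnP i' i) => hlt.
    by case: ifP => ?; [have := ltn_cell hlt hx; lia|apply: hc].
  have -> : i' = i by lia.
  by rewrite (cellD i x); case: ifP => ?; [congr (Some (_ && _)); lia|lia].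
- move=> j hj; rewrite f'E; case: ifP => // ?.
  have hj' : (j == N) || (cell i 0 + R < j) by rewrite cellS in hj; lia.
  by case: ifP => ?; [lia|apply: hN; lia].
Qed.

Lemma wp_prepare (Q : tape -> Prop) :
  (forall c, registers (fun=> N) c -> Q c) ->
  wp prepare ((N * prim.+2).+1 + prim) Q (nth None (map Some w), 0).
Proof.
move=> H; apply: wp_Seq.
apply: (@wp_While (fun k c => transferred (N - k) c /\ k <= N)); last first.
- by rewrite subnn; split=> //; apply: transferred0.
- move=> [f pos] [[/= -> _ _ hc hN] _]; rewrite subn0 in hc hN *.
  have fN : f N = None by rewrite hN ?eqxx.
  rewrite /scanned fN; split=> //.
  have cN : N < cell N 0 by rewrite /cell; lia.
  have Ec : cell N 0 = N.+1 + N * R.+1 by rewrite /cell addn0.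
  apply: (@wp_time (1 + (((cell N 0 - N.+1) * 2).+1 + (1 + (R.+1 + (1 + sweep))))));
    last by rewrite /prim /sweep; lia.
  apply: wp_Seq; apply: wp_Act; rewrite /act /=.
  apply: wp_Seq; apply: wp_scan_right => //.
  + by apply: hN; rewrite leqnn orbT.
  + by move=> j hj; have [|i' [x' [hi' hx' ->]]] := @cellP N j; [lia|rewrite hc].
  apply: wp_Seq; apply: wp_Act; rewrite /act /=.
  apply: wp_Seq; apply: wp_puts => f' f'E.
  apply: wp_Seq; apply: wp_Act; rewrite /act /=.
  have g : grid (bits (fun=> N)) N R (f', (cell N 0 + R)).
    split=> /=; first by rewrite /cell; lia.
    + by rewrite f'E; case: ifP => ?; [lia|rewrite upd_other //; lia].
    + move=> i x hi hx; rewrite f'E /upd /bits.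
      case: (ltnP i N) => hlt.
        have hl := ltn_cell hlt hx.
        case: ifP => ?; first by lia.
        case: ifP => ?; first by lia.
        rewrite hc //; case: (x =P 0) => //= _; congr Some; lia.
      have -> : i = N by lia.
      rewrite (cellD N x) eqxx; case: (x =P 0) => [->|nx].
        by case: ifP => ?; [lia|rewrite addn0 eqxx nth_default].
      by case: ifP => ? //; lia.
  by apply: (wp_home _ _ g) => // c g'; apply: H; split.
move=> k c [tr hk].
have hi : N - k.+1 < N by lia.
have tr' := tr; case: tr' => cE _ hw _ _.
rewrite /scanned cE hw; last lia.
split=> //; apply: wp_If.
rewrite /scanned cE hw; last lia.
have -> : (if marked (Some (nth false w (N - k.+1))) then transfer true
           else transfer false) = transfer (nth false w (N - k.+1)).
  by rewrite /marked; case: (nth _ _ _).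
apply: wp_mono (wp_transfer hi tr) => // c' tr'; split; last lia.
by have -> : N - k = (N - k.+1).+1 by lia.
Qed.
End Layout.

(** * First-order model checking *)

Inductive formula :=
  | Top
  | Atom of bool & nat & nat
  | Neg of formula
  | Conj of formula & formula
  | Ex of formula.

(** Row-major position in the word built by [encode]: the adjacency matrix comes first, and the
    matrix of the relation of lying in one block starts at [n * n]. *)
Definition encode_index (n : nat) (b : bool) (u v : nat) : nat :=
  (if b then n * n else 0) + u * n + v.

(* De Bruijn levels: the quantifier at depth [d] binds variable [d]. *)
Fixpoint eval (n : nat) (w : seq bool) (env : nat -> nat) (d : nat) (f : formula) : bool :=
  match f with
  | Top => true
  | Atom b x y => nth false w (encode_index n b (env x) (env y))
  | Neg f => ~~ eval n w env d f
  | Conj f g => eval n w env d f && eval n w env d g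
  | Ex f => has (fun i => eval n w (upd env d i) d.+1 f) (iota 0 n)
  end.

Fixpoint well_scoped (d : nat) (f : formula) : bool :=
  match f with
  | Top => true
  | Atom _ x y => (x < d) && (y < d)
  | Neg f => well_scoped d f
  | Conj f g => well_scoped d f && well_scoped d g
  | Ex f => well_scoped d.+1 f
  end.

Lemma eval_ext n w f d env env' : well_scoped d f ->
  (forall i, i < d -> env i = env' i) -> eval n w env d f = eval n w env' d f.
Proof.
elim: f d env env' => [|b x y|f IH|f IHf g IHg|f IH] d env env' //=.
- by case/andP=> hx hy E; rewrite !E.
- by move=> hf E; rewrite (IH _ _ env').
- by case/andP=> hf hg E; rewrite (IHf _ _ env') // (IHg _ _ env').
- move=> hf E; apply: eq_has => i; apply: IH => // j hj.
  by rewrite /upd; case: eqP => // ne; apply: E; lia.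
Qed.

(* [rN] holds the order of the graph, [rL] the length of the input, [rO] zero;
   [rZ] is the address accumulator, [rA] and [rC] are loop counters. *)
Notation rN := 1 (only parsing).
Notation rL := 2 (only parsing).
Notation rO := 3 (only parsing).
Notation rZ := 4 (only parsing).
Notation rA := 5 (only parsing).
Notation rC := 6 (only parsing).
Definition var d := 7 + d * 2.
Definition flag d := 8 + d * 2.

(** At depth [d] the last register in use is [6 + d * 2]: this is [rC] for [d = 0] and [flag d.-1]
    otherwise. *)
Fixpoint fits (R d : nat) (f : formula) : bool :=
  match f with
  | Top => true
  | Atom _ _ _ => 6 + d * 2 <= R
  | Neg f => fits R d f
  | Conj f g => fits R d f && fits R d g
  | Ex f => (flag d <= R) && fits R d.+1 f
  end.

Fixpoint room (d : nat) (f : formula) : nat :=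
  match f with
  | Top => 0
  | Atom _ _ _ => 6 + d * 2
  | Neg f => room d f
  | Conj f g => maxn (room d f) (room d g)
  | Ex f => maxn (flag d) (room d.+1 f)
  end.

Lemma fits_room R d f : room d f <= R -> fits R d f.
Proof.
elim: f d => [|b x y|f IH|f IHf g IHg|f IH] d //=.
- exact: IH.
- by rewrite geq_max => /andP[/IHf -> /IHg ->].
- by rewrite geq_max => /andP[-> /IH ->].
Qed.

(** * Register arithmetic and the evaluation of formulas *)

Section Programs.
Variable R : nat.

(** Equality is the only test on registers, so the counter [rA] runs up from 0 to the value of [x],
    which leaves the operand intact. *)
Definition add x := Seq (zero R rA) (until R rA x (Seq (inc R rA) (inc R rZ))).

Definition muladd x y := Seq (zero R rC) (until R rC x (Seq (add y) (inc R rC))).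

(* Searches for the [n] with [n * n + n * n] equal to the input length. *)
Definition find_order :=
  Seq (zero R rN) (Seq (zero R rO) (Seq (zero R rZ) (until R rZ rL
    (Seq (inc R rN) (Seq (zero R rZ) (Seq (muladd rN rN) (muladd rN rN))))))).

(* [flag d] records whether a witness for the quantifier at depth [d] was found. *)
Fixpoint compile (d : nat) (f : formula) (ct cf : prog) : prog :=
  match f with
  | Top => ct
  | Atom b x y =>
      Seq (zero R rZ) (Seq (if b then muladd rN rN else skip)
        (Seq (muladd (var x) rN) (Seq (add (var y)) (branch R rZ 0 ct cf))))
  | Neg f => compile d f cf ct
  | Conj f g => compile d f (compile d g ct cf) cf
  | Ex f =>
      Seq (zero R (flag d)) (Seq (zero R (var d)) (Seq
        (until R (var d) rN (Seq
          (compile d.+1 f (Seq (zero R (flag d)) (inc R (flag d))) skip)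
          (inc R (var d))))
        (branch R (flag d) rO cf ct)))
  end.

Variable w : seq bool.
Local Notation N := (size w).
Local Notation P := (prim w R).

Definition cost_add := P + (P + N * (P + (P + P))).
Definition cost_muladd := P + (P + N * (P + (cost_add + P))).
Definition cost_find_order :=
  P + (P + (P + (P + N * (P + (P + (P + (cost_muladd + cost_muladd))))))).

Fixpoint cost (f : formula) : nat :=
  match f with
  | Top => 0
  | Atom _ _ _ => P + (cost_muladd.+1 + (cost_muladd + (cost_add + P)))
  | Neg f => cost f
  | Conj f g => cost f + cost g
  | Ex f => P + (P + ((P + N * (P + ((cost f + (P + P).+1) + P))) + P))
  end.

Definition same (l : seq nat) (s s' : nat -> nat) : Prop :=
  forall y, y \notin l -> s' y = s y.

Lemma registers_le s c y : registers w R s c -> s y <= N.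
Proof. by case. Qed.

Lemma wp_add s x c (Q : tape -> Prop) : rC <= R -> 0 < x <= R -> x \notin [:: rZ; rA] ->
  s rZ + s x <= N -> registers w R s c ->
  (forall s' c', registers w R s' c' -> s' rZ = s rZ + s x ->
     same [:: rZ; rA] s s' -> Q c') ->
  wp (add x) cost_add Q c.
Proof.
move=> hR hx nx le_N hs H; apply: wp_Seq; apply: (wp_zero _ hs) => [|{hs} c1 hs]; first lia.
apply: (@wp_time (P + s x * (P + (P + P)))); last first.
  by rewrite leq_add2l leq_mul2r (leq_trans _ le_N) ?orbT ?leq_addl.
apply: (@wp_until w R (fun i s' => [/\ s' rA = s x - i, s' rZ = s rZ + (s x - i), i <= s x &
  same [:: rZ; rA] s s']) _ _ _ _ _ _ _ _ _ _ hs) => //; [lia|lia| | | | |].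
- rewrite subnn addn0; split=> // y; rewrite !inE => hy; rewrite upd_other //; lia.
- by move=> i s1 [h1 h2 h3 h4]; rewrite /bits; case: eqP => [|_]; [lia|rewrite h4 // h1; lia].
- by move=> s1 [h1 h2 h3 h4]; rewrite /bits; case: eqP => [|_]; [lia|rewrite h4 // h1; lia].
- move=> i s1 c2 hs1 [h1 h2 h3 h4].
  apply: wp_Seq; apply: (wp_inc _ _ hs1); [lia|lia|move=> c3 hs2].
  apply: (wp_inc _ _ hs2); [lia|by rewrite upd_other //; lia|move=> c4 hs3].
  eexists; first exact: hs3.
  split; first by rewrite upd_other // upd_same; lia.
  + by rewrite upd_same upd_other //; lia.
  + lia.
  + by move=> y hy; rewrite !upd_other ?h4 //; move: hy; rewrite !inE; lia.
- move=> s1 c2 hs1 [h1 h2 _ h4]; apply: (H s1) => //; lia.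
Qed.

Lemma wp_muladd s x y c (Q : tape -> Prop) : rC <= R -> 0 < x <= R -> 0 < y <= R ->
  x \notin [:: rZ; rA; rC] -> y \notin [:: rZ; rA; rC] ->
  s rZ + s x * s y <= N -> registers w R s c ->
  (forall s' c', registers w R s' c' -> s' rZ = s rZ + s x * s y ->
     same [:: rZ; rA; rC] s s' -> Q c') ->
  wp (muladd x y) cost_muladd Q c.
Proof.
move=> hR hx hy nx ny le_N hs H; have sx := registers_le x hs.
apply: wp_Seq; apply: (wp_zero _ hs) => [|{hs} c1 hs]; first lia.
apply: (@wp_time (P + s x * (P + (cost_add + P)))); last first.
  by rewrite leq_add2l leq_mul2r sx orbT.
have ny' : y \notin [:: rZ; rA] by move: ny; rewrite !inE; lia.
apply: (@wp_until w R (fun i s' => [/\ s' rC = s x - i, s' rZ = s rZ + (s x - i) * s y,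
    i <= s x & same [:: rZ; rA; rC] s s']) _ _ _ _ _ _ _ _ _ _ hs) => //;
  [lia| | | | |].
- rewrite subnn mul0n addn0; split=> // z; rewrite !inE => hz; rewrite upd_other //; lia.
- by move=> i s1 [h1 h2 h3 h4]; rewrite /bits; case: eqP => [|_]; [lia|rewrite h4 // h1; lia].
- by move=> s1 [h1 h2 h3 h4]; rewrite /bits; case: eqP => [|_]; [lia|rewrite h4 // h1; lia].
- move=> i s1 c2 hs1 [h1 h2 h3 h4].
  have e1 : (s x - i) * s y = (s x - i.+1) * s y + s y.
    by have -> : s x - i = (s x - i.+1).+1 by [lia]; rewrite mulSn addnC.
  have e2 : (s x - i) * s y <= s x * s y by rewrite leq_mul2r leq_subr orbT.
  apply: wp_Seq; apply: (wp_add hR hy ny' _ hs1) => [|s2 c3 hs2 z2 h5].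
    by rewrite h2 (h4 y) //; lia.
  have hC : s2 rC = s1 rC by apply: h5.
  apply: (wp_inc _ _ hs2) => [||c4 hs3]; [lia|lia|].
  eexists; first exact: hs3.
  split; first by rewrite upd_same; lia.
  + by rewrite upd_other // z2 h2 (h4 y) //; lia.
  + lia.
  + move=> z hz; rewrite upd_other; last by move: hz; rewrite !inE; lia.
    by rewrite h5 ?h4 //; move: hz; rewrite !inE; lia.
- by move=> s1 c2 hs1 [h1 h2 _ h4]; apply: (H s1) => //; rewrite h2 subn0.
Qed.

Lemma wp_find_order n c (Q : tape -> Prop) : rC <= R -> N = n * n + n * n ->
  registers w R (fun=> N) c ->
  (forall s c', registers w R s c' -> s rN = n -> s rO = 0 -> Q c') ->
  wp find_order cost_find_order Q c.
Proof.
move=> hR hN hs H.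
apply: wp_Seq; apply: (wp_zero _ hs) => [|{c hs} c hs]; first lia.
apply: wp_Seq; apply: (wp_zero _ hs) => [|{c hs} c hs]; first lia.
apply: wp_Seq; apply: (wp_zero _ hs) => [|{c hs} c hs]; first lia.
have nN : n <= N by rewrite hN; case: (n) => // m; rewrite mulSn; lia.
apply: (@wp_time (P + n * (P + (P + (P + (cost_muladd + cost_muladd)))))); last first.
  by rewrite leq_add2l leq_mul2r nN orbT.
apply: (@wp_until w R (fun i s => [/\ s rN = n - i,
    s rZ = (n - i) * (n - i) + (n - i) * (n - i), s rO = 0, s rL = N & i <= n])
  _ _ _ _ _ _ _ _ _ _ hs) => //; [lia|lia| | | | |].
- by rewrite subnn.
- move=> i s [h1 h2 h3 h4 h5]; rewrite /bits /= h4 h2 hN.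
  (* The map sending [m] to [m * m + m * m] is strictly increasing, so the loop cannot stop before
     reaching [n]. *)
  have : (n - i.+1) * (n - i.+1) < n * n by apply: ltn_mul; lia.
  by lia.
- by move=> s [h1 h2 h3 h4 h5]; rewrite /bits /= h4 h2 subn0 hN.
- move=> i s c2 hs1 [h1 h2 h3 h4 h5].
  have e : (n - i) * (n - i) <= n * n by apply: leq_mul; lia.
  apply: wp_Seq; apply: (wp_inc _ _ hs1) => [||{c2 hs1} c2 hs1]; [lia|lia|].
  apply: wp_Seq; apply: (wp_zero _ hs1) => [|{c2 hs1} c2 hs1]; first lia.
  set s1 := upd _ rZ 0 in hs1.
  have n1 : s1 rN = n - i by rewrite /s1 upd_other // upd_same; lia.
  have z1 : s1 rZ = 0 by rewrite /s1 upd_same.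
  have o1 : s1 rO = 0 by rewrite /s1 !upd_other.
  have l1 : s1 rL = N by rewrite /s1 !upd_other.
  apply: wp_Seq; apply: (wp_muladd hR _ _ _ _ _ hs1) => //; [lia|lia|by rewrite z1 n1; lia|].
  move=> {c2 hs1} s2 c2 hs2 z2 h6.
  have n2 : s2 rN = n - i by rewrite h6.
  apply: (wp_muladd hR _ _ _ _ _ hs2) => //; [lia|lia|by rewrite z2 z1 n1 n2; lia|].
  move=> s3 c3 hs3 z3 h7; exists s3 => //; split; last lia.
  + by rewrite h7.
  + by rewrite z3 z2 z1 n1 n2.
  + by rewrite h7 // h6.
  + by rewrite h7 // h6.
- by move=> s c2 hs1 [h1 h2 h3 h4 h5]; apply: (H s) => //; rewrite h1 subn0.
Qed.

(** Registers below 4 are constant once the order is known, and those strictly between 6 and [var d]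
    belong to the enclosing quantifiers. Registers 4 to 6 are scratch, and those from [var d] on
    serve the quantifiers of the formula being evaluated. *)
Definition keep d (s s' : nat -> nat) : Prop :=
  forall y, (y < 4) || (6 < y < var d) -> s' y = s y.

(** The truth value is never stored: it selects the continuation [ct] or [cf]. Exactly one of them
    runs, once, so its time is simply added to [cost f]; a conjunction copies [cf] in the program
    text but not in the running time. The invariant [keep] re-establishes the hypotheses on [s] for
    each subformula. *)
Lemma wp_compile n f d s ct cf t c (Q : tape -> Prop) :
  N = n * n + n * n -> well_scoped d f -> fits R d f ->
  (forall i, i < d -> s (var i) < n) -> s rN = n -> s rO = 0 -> registers w R s c ->
  (forall s' c', registers w R s' c' -> keep d s s' ->
     wp (if eval n w (s \o var) d f then ct else cf) t Q c') ->
  wp (compile d f ct cf) (cost f + t) Q c.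
Proof.
move=> hN; have nN : n <= N by rewrite hN; case: (n) => // m; rewrite mulSn; lia.
elim: f d s ct cf t c Q => [|b x y|f IH|f IHf g IHg|f IH] d s ct cf t c Q /=.
- by move=> _ _ _ _ _ hs H; exact: (H s).
- move=> /andP[hx hy] hR hv sN sO hs H.
  apply: (@wp_time (P + (cost_muladd.+1 + (cost_muladd + (cost_add + (P + t)))))); last lia.
  have vx := hv _ hx; have vy := hv _ hy.
  have e1 : s (var x) * n + n <= n * n.
    by have := leq_mul2r n (s (var x)).+1 n; rewrite vx orbT mulSn; lia.
  apply: wp_Seq; apply: (wp_zero _ hs) => [|{c hs} c hs]; first lia.
  set s0 := upd s rZ 0 in hs.
  apply: wp_Seq.
  apply: (@wp_mono _ cost_muladd.+1 _ (fun c' => exists s1, [/\ registers w R s1 c',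
     s1 rZ = if b then n * n else 0 & same [:: rZ; rA; rC] s0 s1])) => //; last first.
    case: b {e1 H}; last first.
      by apply: (@wp_time 1) => //; apply: wp_skip; exists s0.
    apply: (@wp_time cost_muladd) => //.
    have [n0 z0] : s0 rN = n /\ s0 rZ = 0 by [].
    apply: (wp_muladd _ _ _ _ _ _ hs) => //; [lia|lia|lia|by rewrite z0 n0; lia|].
    by move=> s1 c1 hs1 z1 h1; exists s1; split=> //; rewrite z1 n0 z0.
  move=> {c hs} c [s1 [hs z1 h1]].
  have n1 : s1 rN = n by rewrite h1 // /s0 upd_other.
  have v1 i : s1 (var i) = s (var i).
    by rewrite h1 ?inE /var; [rewrite /s0 upd_other //; lia|lia].
  apply: wp_Seq; apply: (wp_muladd _ _ _ _ _ _ hs) => //.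
  + lia.
  + by rewrite /var; lia.
  + lia.
  + by rewrite z1 n1 v1; case: (b); lia.
  move=> s2 {c hs} c hs z2 h2.
  have v2 i : s2 (var i) = s (var i).
    by rewrite h2 ?v1 ?inE /var //; lia.
  apply: wp_Seq; apply: (wp_add _ _ _ _ hs) => //.
  + lia.
  + by rewrite /var; lia.
  + by rewrite z2 z1 n1 v1 v2; case: (b); lia.
  move=> s3 {c hs} c hs z3 h3.
  apply: (wp_branch _ _ hs) => // [|{hs} c1 hs]; first lia.
  rewrite /bits /= z3 z2 z1 n1 v1 v2; apply: H hs _ => z hz.
  rewrite h3; last by rewrite !inE; lia.
  rewrite h2; last by rewrite !inE; lia.
  rewrite h1; last by rewrite !inE; lia.
  by rewrite /s0 upd_other //; lia.
- move=> hf hR hv sN sO hs H; apply: IH hs _ => // s' c' hs' k.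
  by have := H _ _ hs' k; case: eval.
- move=> /andP[hf hg] /andP[hRf hRg] hv sN sO hs H; rewrite -addnA.
  apply: IHf hs _ => // s1 c1 hs1 k1.
  have E i : i < d -> s1 (var i) = s (var i).
    by move=> hi; apply: k1; rewrite /var; lia.
  case Ef: (eval _ _ _ _ f); last first.
    have := H _ _ hs1 k1; rewrite Ef /= => h; apply: wp_time h _; lia.
  apply: IHg hs1 _ => //.
  + by move=> i hi; rewrite E // hv.
  + by rewrite k1.
  + by rewrite k1.
  move=> s2 c2 hs2 k2; have := H s2 c2 hs2; rewrite Ef /=.
  rewrite (@eval_ext n w g d (s1 \o var) (s \o var)) //; apply.
  by move=> y hy; rewrite k2 // k1.
- move=> hf /andP[hR hRf] hv sN sO hs H.
  apply: (@wp_time (P + (P + ((P + N * (P + ((cost f + (P + P).+1) + P))) + (P + t)))));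
    last lia.
  have vR : 0 < var d <= R by move: hR; rewrite /flag /var; lia.
  have fR : 0 < flag d <= R by move: hR; rewrite /flag /var; lia.
  apply: wp_Seq; apply: (wp_zero _ hs) => // {c hs} c hs.
  apply: wp_Seq; apply: (wp_zero _ hs) => // {c hs} c hs.
  apply: wp_Seq.
  (* The loop visits all values below [n] without early exit; after the values below [i], the flag
     equals [found i], read as 0 or 1. *)
  pose found i := has (fun j => eval n w (upd (s \o var) d j) d.+1 f) (iota 0 i).
  apply: (@wp_time (P + n * (P + ((cost f + (P + P).+1) + P)))).
    2: by rewrite leq_add2l leq_mul2r nN orbT.
  apply: (@wp_until w R (fun i s1 => [/\ s1 (var d) = n - i,
      s1 (flag d) = found (n - i), keep d s s1 & i <= n])
    _ _ _ _ _ _ _ _ _ _ hs) => //; [lia| | | | |].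
  + rewrite subnn upd_same upd_other ?upd_same //; last by rewrite /var /flag; lia.
    by split=> // z hz; rewrite !upd_other //; move: hz; rewrite /var /flag; lia.
  + by move=> i s1 [h1 h2 h3 h4]; rewrite /bits /= h1 h3 // sN; lia.
  + by move=> s1 [h1 h2 h3 h4]; rewrite /bits /= h1 h3 // sN; lia.
  + move=> i s1 {c hs} c hs [h1 h2 h3 h4].
    have foundS : found (n - i) =
        found (n - i.+1) || eval n w (upd (s \o var) d (n - i.+1)) d.+1 f.
      have -> : n - i = n - i.+1 + 1 by lia.
      by rewrite /found iotaD has_cat /= orbF add0n.
    apply: wp_Seq; apply: IH hs _ => //.
    * move=> j hj; case: (j =P d) => [->|ne]; first by rewrite h1; lia.
      by rewrite h3 ?hv /var //; lia.
    * by rewrite h3.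
    * by rewrite h3.
    move=> s2 {c} c hs k2.
    rewrite (@eval_ext n w f d.+1 _ (upd (s \o var) d (n - i.+1))) //; last first.
      move=> j hj; rewrite /upd /=; case: (j =P d) => [->|ne] //.
      by rewrite h3 // /var; lia.
    set e := eval _ _ _ _ _.
    have f2 : s2 (flag d) = found (n - i.+1).
      by rewrite k2 // /flag /var; lia.
    have v2 : s2 (var d) = n - i.+1.
      by rewrite k2 // /flag /var; lia.
    have s2k : keep d s s2.
      by move=> z hz; rewrite k2 ?h3 //; move: hz; rewrite /var; lia.
    apply: (@wp_mono _ (P + P) _ (fun c' => exists s3, [/\ registers w R s3 c',
      s3 (flag d) = found (n - i), s3 (var d) = n - i.+1 & keep d s s3])) => //.
      move=> {c hs} c [s3 [hs f3 v3 k3]].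
      apply: (wp_inc _ _ hs) => //; first by rewrite v3; lia.
      move=> {c hs} c hs; eexists; first exact: hs; split.
      * by rewrite upd_same v3; lia.
      * by rewrite upd_other // /flag /var; lia.
      * by move=> z hz; rewrite upd_other ?k3 //; move: hz; rewrite /var; lia.
      * lia.
    rewrite -/e in foundS; case: (e) foundS => foundS; last first.
      apply: (@wp_time 1); last by rewrite /prim; lia.
      by apply: wp_skip; exists s2; split=> //; rewrite foundS orbF.
    (* Resetting before incrementing makes the flag 1 even if an earlier witness has already set it.
       The increment fits because the loop is being executed, so [n], and with it [N], is
       positive. *)
    apply: wp_Seq; apply: (wp_zero _ hs) => // {c hs} c hs.
    apply: (wp_inc _ _ hs) => //.
      by rewrite upd_same hN; case: (n) h4 => // m _; rewrite mulSn; lia.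
    move=> {c hs} c hs; eexists; split; first exact: hs.
    * by rewrite !upd_same foundS orbT.
    * by rewrite !upd_other // /flag /var; lia.
    * by move=> z hz; rewrite !upd_other ?s2k //; move: hz; rewrite /flag /var; lia.
  move=> s1 {c hs} c hs [h1 h2 h3 _].
  apply: (wp_branch _ _ hs) => //; first by move: hR; rewrite /flag; lia.
  move=> {c hs} c hs; have := H _ _ hs h3.
  rewrite /bits /= h2 h3 // sO subn0 -/(found n).
  by case: (found n).
Qed.
End Programs.

(** * Polynomial time bounds *)

(* The shift by 2 makes these bounds closed under sums and products without
   separate constants. *)
Definition polybounded (T : seq bool -> nat) : Prop :=
  exists d, forall w, T w <= (size w).+2 ^ d.

Lemma polybounded_const k : polybounded (fun=> k).
Proof.
exists k => w; apply: leq_trans (ltnW (ltn_expl k (ltnSn 1))) _.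
by case: k => // k; rewrite leq_exp2r.
Qed.

Lemma polybounded_size : polybounded size.
Proof. by exists 1 => w; rewrite expn1; lia. Qed.

Lemma polybounded_mul T T' :
  polybounded T -> polybounded T' -> polybounded (fun w => T w * T' w).
Proof. by move=> [d h] [d' h']; exists (d + d') => w; rewrite expnD leq_mul. Qed.

(** For positive [a] and [b], [a + b <= 2 * (a * b)], and the factor 2 is absorbed by one further
    power of the base, which is at least 2. *)
Lemma polybounded_add T T' :
  polybounded T -> polybounded T' -> polybounded (fun w => T w + T' w).
Proof.
move=> [d h] [d' h']; exists (1 + (d + d')) => w.
rewrite expnD expn1 expnD; have := h w; have := h' w.
set a := _ ^ d; set b := _ ^ d'.
have [a0 b0] : 0 < a /\ 0 < b by rewrite !expn_gt0.
move=> hT' hT; apply: leq_trans (leq_add hT hT') _.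
apply: (@leq_trans (2 * (a * b))); last by rewrite leq_mul2r orbC.
by have := leq_pmulr a b0; have := leq_pmull b a0; lia.
Qed.

Lemma polybounded_succ T : polybounded T -> polybounded (fun w => (T w).+1).
Proof.
move=> h; have [d hd] := polybounded_add (polybounded_const 1) h.
by exists d => w; apply: hd.
Qed.

(** For positive [N] one has [N + 2 <= 3 * N], whence the constant [3 ^ d]; the additive constant
    takes care of the empty word. *)
Lemma polybounded_monomial T : polybounded T ->
  exists c d, forall w, T w <= c * size w ^ d + c.
Proof.
move=> [d h]; exists (3 ^ d), d => w; apply: leq_trans (h w) _.
case: (size w) => [|N].
  by apply: leq_trans (leq_addl _ _); case: d {h} => // d; rewrite leq_exp2r.
apply: leq_trans (leq_addr _ _); rewrite -expnMn.
by case: d {h} => // d; rewrite leq_exp2r //; lia.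
Qed.

Lemma polybounded_prim R : polybounded (prim^~ R).
Proof.
apply: polybounded_mul; first exact: polybounded_const.
apply: polybounded_mul; first exact: polybounded_const.
by do 2 apply: polybounded_succ; apply: polybounded_size.
Qed.

Ltac poly := repeat lazymatch goal with
  | |- polybounded (fun w => _ + _) => apply: polybounded_add
  | |- polybounded (fun w => _ * _) => apply: polybounded_mul
  | |- polybounded (fun w => _.+1) => apply: polybounded_succ
  | |- polybounded size => exact: polybounded_size
  | |- polybounded (fun w => size w) => exact: polybounded_size
  | |- polybounded (fun w => prim w _) => exact: polybounded_prim
  | |- polybounded (fun=> ?k) => exact: polybounded_const
  end.

Lemma polybounded_cost_add R : polybounded (cost_add R).
Proof. by rewrite /cost_add; poly. Qed.

Lemma polybounded_cost_muladd R : polybounded (cost_muladd R).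
Proof. by rewrite /cost_muladd; poly; apply: polybounded_cost_add. Qed.

Lemma polybounded_cost_find_order R : polybounded (cost_find_order R).
Proof. by rewrite /cost_find_order; poly; apply: polybounded_cost_muladd. Qed.

Lemma polybounded_cost R f : polybounded (fun w => cost R w f).
Proof.
elim: f => [|b x y|f IH|f IHf g IHg|f IH] /=; poly => //.
- exact: polybounded_cost_muladd.
- exact: polybounded_cost_muladd.
- exact: polybounded_cost_add.
Qed.

Theorem model_checking_polytime (f : formula) : well_scoped 0 f ->
  exists (M : TM) (c d : nat), tm_accept M != tm_reject M /\
  forall n (w : seq bool) env, size w = n * n + n * n ->
    c_state (tm_run M (c * size w ^ d + c) w) =
    (if eval n w env 0 f then tm_accept M else tm_reject M).
Proof.
move=> cf; pose R := maxn 6 (room 0 f).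
pose answer b := put b Stay.
pose p := Seq (prepare R) (Seq (find_order R) (compile R 0 f (answer true) (answer false))).
(* The inner [1] is the step that writes the answer; the outer successor is the step in which the
   machine reads it off. *)
pose T w := ((size w * (prim w R).+2).+1 + prim w R + (cost_find_order R w + (cost R w f + 1))).+1.
have [|c [d hT]] := @polybounded_monomial T.
  by rewrite /T; poly; [apply: polybounded_cost_find_order|apply: polybounded_cost].
exists (tm_of p), c, d; split=> // n w env hw.
have : wp p (T w).-1 (fun c => scanned c = Some (eval n w env 0 f)) (nth None (map Some w), 0).
  apply: wp_Seq; apply: wp_prepare => c' hs.
  apply: wp_Seq; apply: (wp_find_order _ hw hs); first by rewrite leq_maxl.
  move=> s c2 hs2 sN sO; apply: (wp_compile hw cf _ _ sN sO hs2) => //.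
    by apply: fits_room; rewrite leq_maxr.
  move=> s' c3 _ _; rewrite (@eval_ext n w f 0 _ env) //.
  by case: eval; apply: wp_Act; rewrite /scanned /= upd_same.
case=> c' [t [ht run sc]].
by rewrite (tm_of_correct run sc) //; apply: leq_trans (hT w).
Qed.

(** * Domination and the independence gap *)

Lemma exists_subset_card (T : finType) (A : {set T}) k : k <= #|A| ->
  exists2 B : {set T}, B \subset A & #|B| = k.
Proof.
move=> hk; exists [set x in take k (enum A)].
  by apply/subsetP => x; rewrite inE => /mem_take; rewrite mem_enum.
by rewrite cardsE; have /card_uniqP -> := take_uniq k (enum_uniq A);
  rewrite size_takel // -cardE.
Qed.

Section Domination.
Variables (n : nat) (e : rel 'I_n) (P : {set {set 'I_n}}).
Hypotheses (e_sym : symmetric e) (e_irr : irreflexive e) (cliqueP : clique_partition e P).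

Lemma indepP (S : {set 'I_n}) :
  reflect (forall u v, u \in S -> v \in S -> ~~ e u v) (is_indep e S).
Proof.
apply: (iffP idP) => [h u v uS vS|h].
  have /forall_inP/(_ u uS)/forall_inP/(_ v vS) := h.
  by case: eqP => [->|//]; rewrite e_irr.
by apply/forall_inP => u uS; apply/forall_inP => v vS; rewrite h ?implybT.
Qed.

Lemma indep_sub (S T : {set 'I_n}) : S \subset T -> is_indep e T -> is_indep e S.
Proof.
by move=> /subsetP sST /indepP h; apply/indepP => u v /sST uT /sST; apply: h.
Qed.

Lemma clique_sub (S T : {set 'I_n}) : S \subset T -> is_clique e T -> is_clique e S.
Proof.
move=> /subsetP sST h; apply/forall_inP => u /sST uT; apply/forall_inP => v /sST vT.
by have /forall_inP/(_ u uT)/forall_inP/(_ v vT) := h.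
Qed.

Lemma maximal_indepP (S : {set 'I_n}) y : is_maximal_indep e S -> y \notin S ->
  exists2 t, t \in S & e t y.
Proof.
case/andP=> iS /forallP/(_ (y |: S)) + yS.
rewrite properUr ?sub1set //= => h; apply/exists_inP; apply: contraR h.
rewrite negb_exists_in => /forall_inP h; apply/indepP => u v.
rewrite !inE => /orP[/eqP->|uS] /orP[/eqP->|vS]; rewrite ?e_irr //.
- by rewrite e_sym h.
- exact: h.
- by move/indepP: iS; apply.
Qed.

Lemma exists_maximal_indep (T : {set 'I_n}) : is_indep e T ->
  exists2 S : {set 'I_n}, is_maximal_indep e S & T \subset S.
Proof.
move=> iT; have [S /maxsetP[iS mS] sTS] := maxset_exists iT; exists S => //.
rewrite /is_maximal_indep iS; apply/forallP => U; apply/implyP => pSU.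
by apply/negP => iU; have E := mS U iU (proper_sub pSU); rewrite E properxx in pSU.
Qed.

Lemma indep_dom_le (S : {set 'I_n}) : is_maximal_indep e S -> indep_dom e <= #|S|.
Proof.
move=> mS; rewrite /indep_dom; have := mem_index_enum S.
elim: (index_enum _) => // T r IH; rewrite inE big_cons => /orP[/eqP<-|/IH h].
  by rewrite mS geq_minl.
by case: ifP => // _; apply: leq_trans (geq_minr _ _) h.
Qed.

(** The iterated minimum starts from [n], hence the condition [m <= n]. *)
Lemma indep_dom_ge m : m <= n ->
  (forall S : {set 'I_n}, is_maximal_indep e S -> m <= #|S|) -> m <= indep_dom e.
Proof. by move=> mn h; rewrite /indep_dom; elim/big_ind: _ => // x y hx hy; rewrite leq_min hx. Qed.

Lemma alpha_le : alpha e <= n.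
Proof. by apply/bigmax_leqP => S _; rewrite -[n in _ <= n]card_ord max_card. Qed.

Lemma clique_partition_trivIset : [/\ cover P = setT, trivIset P & set0 \notin P].
Proof. by case: cliqueP => /and3P[/eqP ? ? ?]. Qed.

Lemma mem_pblockT x : x \in pblock P x.
Proof. by case: clique_partition_trivIset => cP _ _; rewrite mem_pblock cP inE. Qed.

Lemma pblockT_mem x : pblock P x \in P.
Proof. by case: clique_partition_trivIset => cP _ _; rewrite pblock_mem // cP inE. Qed.

Lemma pblock_inj_indep (S : {set 'I_n}) : is_indep e S -> {in S &, injective (pblock P)}.
Proof.
move=> /indepP iS x y xS yS E; apply/eqP; case: eqP => // /eqP ne.
have [_ /(_ _ (pblockT_mem x)) /forall_inP/(_ x (mem_pblockT x))] := cliqueP.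
move/forall_inP/(_ y); rewrite E mem_pblockT => /(_ isT); rewrite ne /=.
by rewrite (negbTE (iS _ _ xS yS)).
Qed.

Lemma clique_card p (C : {set 'I_n}) : Kp_free e p -> is_clique e C -> #|C| <= p.
Proof.
move=> free cC; rewrite leqNgt; apply/negP => /ltnW /exists_subset_card[B sBC cB].
exact: free (clique_sub sBC cC) cB.
Qed.

(* A maximal independent set misses a block exactly when it dominates it, and
   one dominating vertex per vertex of the missed blocks is enough. *)
Lemma gap_domination p k : Kp_free e p -> #|P| = alpha e -> k < mu_alpha e ->
  exists (U : {set {set 'I_n}}) (T : {set 'I_n}),
  [/\ U \subset P, #|U| = k.+1, is_indep e T, #|T| <= k.+1 * p &
      forall y, pblock P y \in U -> exists2 t, t \in T & e t y].
Proof.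
move=> free cP gap; have al := alpha_le.
have [S mS lS] : exists2 S : {set 'I_n}, is_maximal_indep e S & #|S| + k < alpha e.
  (* Otherwise every maximal independent set has at least [alpha e - k] vertices, hence so does the
     smallest one. *)
  apply/exists_inP; apply: contraLR gap => /exists_inPn h.
  rewrite -leqNgt /mu_alpha leq_subLR addnC -leq_subLR; apply: indep_dom_ge; first lia.
  by move=> S /h; lia.
pose M := [set C in P | [disjoint C & S]].
have cM : k.+1 <= #|M|.
  (* A block that is not missed is the block of some vertex of [S], so there are at most [#|S|] of
     these; as [#|P| = alpha e] exceeds [#|S| + k], more than [k] blocks are missed. *)
  have sPM : P :\: M \subset pblock P @: S.
    apply/subsetP => C; rewrite !inE => /andP[+ CP]; rewrite CP /=.
    case/pred0Pn => x /andP[/= xC xS]; apply/imsetP; exists x => //.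
    by case: clique_partition_trivIset => _ tP _; rewrite (def_pblock tP CP xC).
  have h1 : #|P :\: M| <= #|S| := leq_trans (subset_leq_card sPM) (leq_imset_card _ _).
  have h2 : #|P :&: M| <= #|M| := subset_leq_card (subsetIr P M).
  by have h3 : #|P :&: M| + #|P :\: M| = #|P| := cardsID M P; lia.
have [U sUM cU] := exists_subset_card cM.
have sUP : U \subset P by apply: subset_trans sUM _; apply/subsetP => C; rewrite inE => /andP[].
have dom y : pblock P y \in U -> exists2 t, t \in S & e t y.
  move=> yU; apply: maximal_indepP mS _; apply/negP => yS.
  have := subsetP sUM _ yU; rewrite inE => /andP[_ /pred0P/(_ y)] /=.
  by rewrite mem_pblockT yS.
(* [f y] is a chosen dominator of [y]; the default is never reached on the blocks of [U]. *)
pose f y := odflt y [pick t in S | e t y].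
have fP y : pblock P y \in U -> f y \in S /\ e (f y) y.
  move=> /dom[t tS ety]; rewrite /f; case: pickP => [x /andP[]//|/(_ t)].
  by rewrite /= tS ety.
exists U, (f @: cover U); split=> //.
- apply: (@indep_sub _ S); last by case/andP: mS.
  apply/subsetP => _ /imsetP[y /bigcupP[C CU yC] ->].
  case: clique_partition_trivIset => _ tP _.
  by have [] := fP y; rewrite ?(def_pblock tP (subsetP sUP _ CU) yC).
- apply: leq_trans (leq_imset_card _ _) _; apply: leq_trans (leq_card_cover U) _.
  rewrite -cU -sum_nat_const; apply: leq_sum => C CU; apply: clique_card free _.
  by case: cliqueP => _; apply; apply: (subsetP sUP).
- move=> y yU; have [_ ey] := fP _ yU; exists (f y) => //; apply: imset_f.
  by apply/bigcupP; exists (pblock P y) => //; apply: mem_pblockT.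
Qed.

(** Extend [T] to a maximal independent set [S]. A vertex of [S] in a block of [U] would be adjacent
    to a vertex of [T], hence of [S], so [S] avoids these blocks. Having at most one vertex in each
    remaining block, it has at most [alpha e - #|U|] vertices. *)
Lemma domination_gap k (U : {set {set 'I_n}}) (T : {set 'I_n}) :
  #|P| = alpha e -> U \subset P -> k < #|U| -> is_indep e T ->
  (forall y, pblock P y \in U -> exists2 t, t \in T & e t y) -> k < mu_alpha e.
Proof.
move=> cP sUP cU iT dom; have [S mS sTS] := exists_maximal_indep iT.
have iS : is_indep e S by case/andP: mS.
have sub : pblock P @: S \subset P :\: U.
  apply/subsetP => _ /imsetP[y yS ->]; rewrite inE pblockT_mem andbT.
  apply/negP => /dom[t /(subsetP sTS) tS ety].
  by move/indepP/(_ t y tS yS): iS; rewrite ety.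
have h1 : #|S| <= #|P :\: U|.
  by rewrite -(card_in_imset (pblock_inj_indep iS)) subset_leq_card.
have h2 : #|U| + #|P :\: U| = #|P| by rewrite -(cardsID U P) (setIidPr sUP).
by have := indep_dom_le mS; rewrite /mu_alpha; lia.
Qed.
End Domination.

(** * The gap as a first-order property *)

Lemma nth_allpairs S T V (f : S -> T -> V) s0 t0 v0 s t i j :
  i < size s -> j < size t ->
  nth v0 [seq f x y | x <- s, y <- t] (i * size t + j) = f (nth s0 s i) (nth t0 t j).
Proof.
elim: s i => //= x s IH [|i] hi hj; rewrite nth_cat size_map.
  by rewrite mul0n add0n hj (nth_map t0).
by rewrite mulSn -addnA ltnNge leq_addr addKn IH.
Qed.

Lemma size_encode n (e : rel 'I_n) P : size (encode e P) = n * n + n * n.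
Proof. by rewrite size_cat !size_allpairs size_enum_ord. Qed.

Lemma nth_encode n (e : rel 'I_n) P b (u v : 'I_n) :
  nth false (encode e P) (encode_index n b u v) =
  if b then pblock P u == pblock P v else e u v.
Proof.
have H (f : rel 'I_n) :
    nth false [seq f x y | x <- enum 'I_n, y <- enum 'I_n] (u * n + v) = f u v.
  have := @nth_allpairs _ _ _ f u v false (enum 'I_n) (enum 'I_n) u v.
  by rewrite !nth_ord_enum size_enum_ord; apply.
have lt : u * n + v < n * n.
  by have := leq_mul2r n u.+1 n; rewrite ltn_ord orbT mulSn; have := ltn_ord v; lia.
rewrite /encode /encode_index nth_cat size_allpairs size_enum_ord; case: b => /=.
  by rewrite -addnA ltnNge leq_addr addKn H.
by rewrite add0n lt H.
Qed.

Definition conjs (l : seq formula) : formula := foldr Conj Top l.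
Definition disjs (l : seq formula) : formula := Neg (conjs (map Neg l)).

Lemma eval_conjs n w env d l : eval n w env d (conjs l) = all (eval n w env d) l.
Proof. by elim: l => //= f l ->. Qed.

Lemma eval_disjs n w env d l : eval n w env d (disjs l) = has (eval n w env d) l.
Proof.
by rewrite /= eval_conjs all_map -has_predC /=; apply: eq_has => f /=; rewrite negbK.
Qed.

Lemma well_scoped_conjs d l : well_scoped d (conjs l) = all (well_scoped d) l.
Proof. by elim: l => //= f l ->. Qed.

Lemma well_scoped_disjs d l : well_scoped d (disjs l) = all (well_scoped d) l.
Proof. by rewrite /= well_scoped_conjs all_map. Qed.

Definition forall_implies (f g : formula) : formula := Neg (Ex (Conj f (Neg g))).

Lemma eval_forall_implies n w env d f g :
  eval n w env d (forall_implies f g) =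
  all (fun i => eval n w (upd env d i) d.+1 f ==> eval n w (upd env d i) d.+1 g) (iota 0 n).
Proof.
by rewrite /= -all_predC; apply: eq_all => i /=; rewrite negb_and negbK implybE.
Qed.

Lemma well_scoped_forall_implies d f g :
  well_scoped d (forall_implies f g) = well_scoped d.+1 f && well_scoped d.+1 g.
Proof. by []. Qed.

Definition exists_many k (f : formula) : formula := iter k Ex f.

Lemma well_scoped_exists_many k f d : well_scoped d (exists_many k f) = well_scoped (d + k) f.
Proof. by elim: k d => [|k IH] d /=; rewrite ?addn0 // IH addSnnS. Qed.

Lemma eval_exists_many n w k f env d : well_scoped (d + k) f ->
  eval n w env d (exists_many k f) <->
  exists env', [/\ forall i, i < d -> env' i = env i,
    forall i, d <= i < d + k -> env' i < n & eval n w env' (d + k) f].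
Proof.
elim: k env d => [|k IH] env d.
  rewrite addn0 => cf; split=> [h|[env' [h1 _ h2]]].
    by exists env; split=> // i; lia.
  by rewrite /= (eval_ext _ _ cf (env' := env')) // => i /h1.
rewrite addnS -addSn => cf; split=> [|[env' [h1 h2 h3]]].
  case/hasP => v; rewrite mem_iota => hv /(IH _ _ cf)[env' [h1 h2 h3]].
  exists env'; split=> // i hi; first by rewrite h1 ?upd_other //; lia.
  by case: (i =P d) => [->|ne]; [rewrite h1 // upd_same|apply: h2; lia].
apply/hasP; exists (env' d); first by rewrite mem_iota h2 //; lia.
apply/(IH _ _ cf); exists env'; split=> // i hi; last by apply: h2; lia.
by rewrite /upd; case: eqP => [->|ne] //; apply: h1; lia.
Qed.

Lemma all_iotaP (a : pred nat) i k :
  reflect (forall j, i <= j < i + k -> a j) (all a (iota i k)).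
Proof.
by apply: (iffP allP) => h j hj; apply: h; rewrite mem_iota in hj *.
Qed.

Lemma has_iotaP (a : pred nat) i k :
  reflect (exists2 j, i <= j < i + k & a j) (has a (iota i k)).
Proof.
by apply: (iffP hasP) => -[j hj aj]; exists j; rewrite // mem_iota in hj *.
Qed.

Section GapFormula.
Variables r m : nat.

Definition distinct_blocks : formula :=
  conjs [seq conjs [seq Neg (Atom true i j) | j <- iota 0 i] | i <- iota 0 r].

Definition independent : formula :=
  conjs [seq conjs [seq Neg (Atom false i j) | j <- iota r m] | i <- iota r m].

Definition dominating : formula :=
  forall_implies (disjs [seq Atom true i (r + m) | i <- iota 0 r])
                 (disjs [seq Atom false j (r + m) | j <- iota r m]).

(* Levels [0 .. r-1] are block representatives, [r .. r+m-1] the dominating set;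
   [dominating] binds level [r + m]. *)
Definition gap_formula : formula :=
  exists_many (r + m) (Conj distinct_blocks (Conj independent dominating)).

Lemma well_scoped_gap_formula : well_scoped 0 gap_formula.
Proof.
have c1 : well_scoped (r + m) distinct_blocks.
  rewrite well_scoped_conjs all_map; apply/all_iotaP => i hi /=.
  by rewrite well_scoped_conjs all_map; apply/all_iotaP => j hj /=; lia.
have c2 : well_scoped (r + m) independent.
  rewrite well_scoped_conjs all_map; apply/all_iotaP => i hi /=.
  by rewrite well_scoped_conjs all_map; apply/all_iotaP => j hj /=; lia.
have c3 : well_scoped (r + m) dominating.
  rewrite well_scoped_forall_implies !well_scoped_disjs !all_map.
  by apply/andP; split; apply/all_iotaP => i hi /=; lia.
by rewrite well_scoped_exists_many add0n; apply/and3P.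
Qed.

Variables (n : nat) (e : rel 'I_n) (P : {set {set 'I_n}}).

(** A block is represented by any of its vertices. Repetitions among the [t j] are allowed, so a
    list of length [m] describes any nonempty set of at most [m] vertices. *)
Definition gap_witness (u t : nat -> 'I_n) : Prop :=
  [/\ forall i j, i < r -> j < i -> pblock P (u i) != pblock P (u j),
      forall i j, i < m -> j < m -> ~~ e (t i) (t j) &
      forall y i, i < r -> pblock P (u i) == pblock P y ->
        exists2 j, j < m & e (t j) y].

Lemma eval_matrix (u t : nat -> 'I_n) (env : nat -> nat) :
  (forall i, i < r -> env i = u i) -> (forall j, j < m -> env (r + j) = t j) ->
  eval n (encode e P) env (r + m) (Conj distinct_blocks (Conj independent dominating)) <->
  gap_witness u t.
Proof.
move=> hu ht.
have atom (env' : nat -> nat) b x y (i j : 'I_n) : env' x = i -> env' y = j ->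
    nth false (encode e P) (encode_index n b (env' x) (env' y)) =
    if b then pblock P i == pblock P j else e i j.
  by move=> -> ->; rewrite nth_encode.
have Y y z : z < r + m -> upd env (r + m) y z = env z by move=> h; rewrite upd_other //; lia.
have D : eval n (encode e P) env (r + m) distinct_blocks <->
    forall i j, i < r -> j < i -> pblock P (u i) != pblock P (u j).
  rewrite eval_conjs all_map; split => [/all_iotaP h i j hi hj|h].
    have := h i hi; rewrite /= eval_conjs all_map => /all_iotaP/(_ j hj) /=.
    by rewrite (atom _ _ _ _ (u i) (u j)) ?hu //; lia.
  apply/all_iotaP => i hi /=; rewrite eval_conjs all_map; apply/all_iotaP => j hj /=.
  by rewrite (atom _ _ _ _ (u i) (u j)) ?hu ?h //; lia.
have I : eval n (encode e P) env (r + m) independent <->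
    forall i j, i < m -> j < m -> ~~ e (t i) (t j).
  rewrite eval_conjs all_map; split => [/all_iotaP h i j hi hj|h].
    have /h : r <= r + i < r + m by lia.
    rewrite /= eval_conjs all_map => /all_iotaP h'.
    have /h' : r <= r + j < r + m by lia.
    by rewrite /= (atom _ _ _ _ (t i) (t j)) ?ht.
  apply/all_iotaP => i hi /=; rewrite eval_conjs all_map; apply/all_iotaP => j hj /=.
  rewrite -(subnKC (proj1 (andP hi))) -(subnKC (proj1 (andP hj))).
  by rewrite (atom _ _ _ _ (t (i - r)) (t (j - r))) ?ht ?h //; lia.
have M : eval n (encode e P) env (r + m) dominating <->
    forall y i, i < r -> pblock P (u i) == pblock P y -> exists2 j, j < m & e (t j) y.
  have H1 (y : 'I_n) : eval n (encode e P) (upd env (r + m) y) (r + m).+1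
    (disjs [seq Atom true i (r + m) | i <- iota 0 r]) <-> exists2 i, i < r & pblock P (u i) == pblock P y.
    rewrite eval_disjs has_map; split=> [/has_iotaP|] [i hi] /=.
      by rewrite (atom _ _ _ _ (u i) y) ?upd_same ?Y ?hu //; [exists i|lia].
    move=> h; apply/has_iotaP; exists i => //=.
    by rewrite (atom _ _ _ _ (u i) y) ?upd_same ?Y ?hu //; lia.
  have H2 (y : 'I_n) : eval n (encode e P) (upd env (r + m) y) (r + m).+1
    (disjs [seq Atom false i (r + m) | i <- iota r m]) <-> exists2 j, j < m & e (t j) y.
    rewrite eval_disjs has_map; split=> [/has_iotaP|] [i hi] /=.
      have -> : i = r + (i - r) by lia.
      by rewrite (atom _ _ _ _ (t (i - r)) y) ?upd_same ?Y ?ht //; [exists (i - r) => //|..]; lia.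
    move=> h; apply/has_iotaP; exists (r + i) => /=; first lia.
    by rewrite (atom _ _ _ _ (t i) y) ?upd_same ?Y ?ht //; lia.
  rewrite eval_forall_implies; split => [/all_iotaP h y i hi hy|h].
    by apply/H2; apply: (implyP (h y (ltn_ord y))); apply/H1; exists i.
  apply/all_iotaP => y hy; apply/implyP => /(H1 (Ordinal hy))[i hi hyi].
  by apply/(H2 (Ordinal hy)); apply: h hyi.
split=> [/and3P[/D h1 /I h2 /M h3] //|[/D h1 /I h2 /M h3]].
by apply/and3P.
Qed.
End GapFormula.

Lemma gapP r m n (e : rel 'I_n) (P : {set {set 'I_n}}) env : 0 < r ->
  eval n (encode e P) env 0 (gap_formula r m) <->
  exists u t, gap_witness r m e P u t.
Proof.
move=> r0; have := well_scoped_gap_formula r m; rewrite well_scoped_exists_many => cf.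
split=> [/(eval_exists_many _ _ _ cf)[env' [_ h1 h2]]|[u [t h]]].
  (* Since [r] is positive, some variable is quantified and takes a value below [n]; this supplies
     the default vertex for [insubd]. *)
  have n0 : 0 < n by have := h1 0; rewrite add0n; lia.
  pose x i := insubd (Ordinal n0) (env' i).
  have xE i : i < r + m -> env' i = x i.
    by move=> hi; rewrite /x val_insubd h1.
  exists x, (fun j => x (r + j)); apply/eval_matrix; last exact: h2.
    by move=> i hi; apply: xE; lia.
  by move=> i hi; apply: xE; lia.
apply/(eval_exists_many _ _ _ cf).
exists (fun i => if i < r then u i else t (i - r)); split=> //.
rewrite add0n; apply/(@eval_matrix _ _ _ _ _ u t) => // [i ->//|j hj].
by rewrite ltnNge leq_addr addKn.
Qed.

Lemma gap_witness_exists p k n (e : rel 'I_n) (P : {set {set 'I_n}}) :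
  symmetric e -> irreflexive e -> Kp_free e p -> clique_partition e P ->
  #|P| = alpha e ->
  (exists u t, gap_witness k.+1 (k.+1 * p) e P u t) <-> k < mu_alpha e.
Proof.
move=> e_sym e_irr free cliqueP cP.
have trivP : trivIset P by case: cliqueP => /and3P[].
split=> [[u [t [h1 h2 h3]]]|].
  pose U := [set pblock P (u i) | i : 'I_k.+1].
  pose T := [set t j | j : 'I_(k.+1 * p)].
  apply: (@domination_gap _ e P e_irr cliqueP k U T) => //.
  - by apply/subsetP => _ /imsetP[i _ ->]; apply: pblockT_mem cliqueP _.
  - rewrite card_imset ?card_ord // => i j E; apply/val_inj.
    case: (ltngtP i j) => // hij; [have := h1 j i (ltn_ord j) hij|have := h1 i j (ltn_ord i) hij];
      by rewrite E eqxx.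
  - apply/(indepP e_irr) => _ _ /imsetP[i _ ->] /imsetP[j _ ->]; exact: h2.
  - move=> y /imsetP[i _ E]; have [||j hj ey] := h3 y i; rewrite ?E //.
    by exists (t j) => //; apply/imsetP; exists (Ordinal hj).
move=> gap; have [U [T [sUP cU iT cT dom]]] := gap_domination e_sym e_irr cliqueP free cP gap.
have [C0 C0U] : exists C, C \in U by apply/card_gt0P; rewrite cU.
have ne C : C \in U -> exists x, x \in C.
  move=> CU; apply/set0Pn; apply: contraTneq (subsetP sUP _ CU) => ->.
  by case: cliqueP => /and3P[].
have [x0 x0C] := ne _ C0U.
have blk C x : C \in U -> x \in C -> pblock P x = C.
  by move=> CU xC; apply: def_pblock trivP (subsetP sUP _ CU) xC.
have [t0 t0T _] : exists2 t, t \in T & e t x0 by apply: dom; rewrite (blk C0).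
pose u i := odflt x0 [pick x in nth C0 (enum U) i].
have nthU i : i < k.+1 -> nth C0 (enum U) i \in U.
  by move=> hi; rewrite -mem_enum mem_nth // -cardE cU.
have uE i : i < k.+1 -> pblock P (u i) = nth C0 (enum U) i.
  move=> /nthU hi; apply: blk => //; rewrite /u; case: pickP => //= no.
  by have [x xC] := ne _ hi; have := no x; rewrite xC.
(* The enumeration of [T] is padded with [t0] up to the required length. As [t0] itself lies in [T],
   the padding preserves independence. That [T] is nonempty follows from the domination of [x0]. *)
pose t j := nth t0 (enum T) j.
have tT j : t j \in T.
  rewrite /t; case: (ltnP j (size (enum T))) => hj; last by rewrite nth_default.
  by rewrite -mem_enum mem_nth.
exists u, t; split=> [i j hi hj|i j _ _|y i hi /eqP E].
- rewrite !uE ?(ltn_trans hj hi) // nth_uniq ?enum_uniq -?cardE ?cU ?(ltn_trans hj hi) //; lia.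
- by have /(indepP e_irr) := iT; apply.
- have [|s sT es] := dom y; first by rewrite -E uE ?nthU.
  exists (index s (enum T)).
    by apply: leq_trans cT; rewrite cardE index_mem mem_enum.
  by rewrite /t nth_index ?mem_enum.
Qed.

Theorem mainTheorem6 :
  forall p k : nat, 0 < p -> 0 < k ->
  exists (M : TM) (c d : nat),
    tm_accept M != tm_reject M /\
    forall (n : nat) (e : rel 'I_n) (P : {set {set 'I_n}}),
      symmetric e -> irreflexive e ->
      Kp_free e p -> semi_perfect e ->
      clique_partition e P -> #|P| = alpha e ->
      let w := encode e P in
      c_state (tm_run M (c * (size w) ^ d + c) w) =
        (if mu_alpha e <= k then tm_accept M else tm_reject M).
Proof.
move=> p k _ _; pose f := gap_formula k.+1 (k.+1 * p).
have cf : well_scoped 0 (Neg f) := well_scoped_gap_formula k.+1 (k.+1 * p).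
have [M [c [d [ne hM]]]] := model_checking_polytime cf.
exists M, c, d; split=> // n e P e_sym e_irr free _ cliqueP cP w.
(* The formula is closed, so the environment [id] is an arbitrary choice. *)
rewrite (hM n w id) ?size_encode //= leqNgt; congr (if ~~ _ then _ else _).
have [h1 h2] := @gapP k.+1 (k.+1 * p) n e P id isT.
have [h3 h4] := gap_witness_exists k e_sym e_irr free cliqueP cP.
by apply/idP/idP => [/h1/h3|/h4/h2].
Qed.
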